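(* Let $V$ be a symplectic vector space over $\mathbb C$ with symplectic form $\Omega$, $\{e_a\}$ a basis of $V$, $\Omega_{ab}=\Omega(e_a,e_b)$, and let ${\rm Sb}[V]$ be the symplectic boson VOA with generators $q^a$, equipped with the filtration $\mathfrak R_\bullet$ induced by giving each $q^a$ degree $\frac12$, its invariant bilinear form $(-,-)$, and the anti-linear map $\rho$ determined by $\rho(q^a)=-\Omega_{ab}q^b$. The filtration $\mathfrak R_\bullet$ is a nondegenerate half-integral good filtration and $\rho$ defines a quaternionic structure. Moreover, the pairing $\langle x|x\rangle=((\sigma\circ\rho)(x),x)$ is positive-definite, hence this data equips ${\rm Sb}[V]$ with the structure of a graded-unitary VOA.
   Context: Repeated indices are summed; $\Omega^{ab}$ is the inverse matrix, $\Omega_{ab}\Omega^{bc}=\delta_a^c$. Vertex algebras are over $\mathbb C$, $|x|$ is Grassmann parity, $Y(x,z)=\sum_nx_nz^{-n-1}$, $|0\rangle$ is the vacuum, $\partial$ is translation. ${\rm Sb}[V]$ is freely generated by $\dim V$ Grassmann-even fields $q^a(z)=\sum_nq^a_nz^{-n-1}$ with $q^a(z)q^b(w)\sim\frac{\Omega^{ab}}{z-w}$, i.e. $[q^a_n,q^b_m]=\Omega^{ab}\delta_{n+m+1,0}$, and has stress tensor $T=\frac12\Omega_{ab}:\!q^b\partial q^a\!:$, giving $q^a$ conformal weight $\frac12$. $L_{\pm1},L_0$ are modes of $T(z)=\sum_nL_nz^{-n-2}$. A bilinear form is invariant if $(Y(x,z)u,v)=(-1)^{|x||u|}(u,Y(e^{zL_1}(e^{\mathrm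 i\pi}z^{-2})^{L_0}x,z^{-1})v)$ and $(L_mu,v)=(u,L_{-m}v)$, $m\in\{-1,0,1\}$; the form used is the unique invariant one with $(|0\rangle,|0\rangle)=1$. Grading and filtration: ${\rm Sb}[V]_{\ell/2}={\rm span}\{q^{a_1}_{-n_1-1}\cdots q^{a_\ell}_{-n_\ell-1}|0\rangle\}$ (with $n_i\ge0$) for $\ell\ge0$ and $0$ for $\ell<0$; $\mathfrak R_{p+\alpha}{\rm Sb}[V]=\bigoplus_{p'\in\mathbb Z,\,p'\le p}{\rm Sb}[V]_{p'+\alpha}$ for $p\in\mathbb Z$, $\alpha\in\{0,\frac12\}$. The $\mathbb Z_2$ parity $s$ acts by $(-1)^{2R}$ on ${\rm Sb}[V]_R$. The map $\rho$ is the anti-linear extension of $\rho(q^{a_1}_{-n_1-1}\cdots q^{a_\ell}_{-n_\ell-1}|0\rangle)=(-1)^\ell\Omega_{a_1b_1}\cdots\Omega_{a_\ell b_\ell}q^{b_1}_{-n_1-1}\cdots q^{b_\ell}_{-n_\ell-1}|0\rangle$. Half-integral filtration of a $\mathbb Z_2$-graded vertex algebra $\mathcal V=\mathcal V^0\oplus\mathcal V^{1/2}$: increasing (in integer steps) and exhaustive, with components $\mathcal F_p\subseteq\mathcal V^0$ for $p\in\mathbb Z$ and $\mathcal F_p\subseteq\mathcal V^{1/2}$ for $p\in\frac12+\mathbb Z$, $|0\rangle\in\mathcal F_0$, and $x_ny\in\mathcal F_{p+q}$ for $x\in\mathcal F_p$, $y\in\mathcal F_q$, $n\in\mathbb Z$;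 good if also $x_ny\in\mathcal F_{p+q-1}$ for $n\ge0$; nondegenerate if $(-,-)$ restricts nondegenerately to every filtered component. A nondegenerate filtration is refined by orthogonality to a grading $\bigoplus\mathcal V_{h,R}$ ($h$ conformal weight, $R$ filtration degree), and $\sigma$ acts by $\mathrm i^{2R}$ on degree $R$, so $\sigma^2=s$. A conjugation is an anti-linear isomorphism $\rho$ that commutes with $\partial$, fixes $|0\rangle$, satisfies $\rho(x_ny)=(-1)^{|x||y|}\rho(x)_n\rho(y)$, and preserves the conformal vector and each filtered component; it is a quaternionic structure if $\rho\circ\rho=s$ and $\rho\circ\sigma=\sigma^{-1}\circ\rho$. A graded-unitary VOA is a VOA with a nondegenerate invariant bilinear form, a nondegenerate half-integral good filtration and a quaternionic structure such that the Hermitian form $\langle x|y\rangle=((\sigma\circ\rho)(x),y)$ is positive-definite.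
   Formalization: That ρ is a quaternionic structure, and hence the graded-unitary VOA structure, is stated only for bases {e_a} with Ω_ab a unitary matrix (e.g. Darboux); it fails otherwise: if Ω_ab is twice a Darboux matrix, ρρ(q^a) = -4q^a. The other claims hold for every basis. *)

(* Defs.v *)
From mathcomp Require Import all_boot all_order all_algebra.
From mathcomp Require Export complex.
From mathcomp Require Import boolp classical_sets reals.

Set Implicit Arguments.
Unset Strict Implicit.
Unset Printing Implicit Defensive.

Import Order.TTheory GRing.Theory Num.Theory.

Local Open Scope classical_set_scope.
Local Open Scope ring_scope.

Section LinearAlgebra.
Variables (C : numClosedFieldType) (A : lmodType C).

Definition subspace (P : set A) : Prop :=
  P 0 /\ forall (c : C) (x y : A), P x -> P y -> P (c *: x + y).

Definition lspan (P : set A) : set A :=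
  [set x | exists (n : nat) (c : 'I_n -> C) (v : 'I_n -> A),
     (forall i, P (v i)) /\ x = \sum_(i < n) c i *: v i].

Definition direct_decomposition (P : bool -> set A) : Prop :=
  [/\ forall b, subspace (P b),
      forall x, exists x0 x1, [/\ P false x0, P true x1 & x = x0 + x1]
    & forall x, P false x -> P true x -> x = 0].

Definition antilinear (f : A -> A) : Prop :=
  forall (c : C) (x y : A), f (c *: x + y) = c^* *: f x + f y.

Definition nondegenerate_on (form : A -> A -> C) (P : set A) : Prop :=
  (forall x, P x -> (forall y, P y -> form x y = 0) -> x = 0) /\
  (forall y, P y -> (forall x, P x -> form x y = 0) -> y = 0).

End LinearAlgebra.

Definition binz (C : numClosedFieldType) (m : int) (j : nat) : C :=
  (\prod_(i < j) (m%:~R - i%:R)) / (j`!)%:R.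

(* [vprod A n x y] is the n-th product x_n y, where Y(x,z) = \sum_n x_n z^(-n-1).
   [parity A false] and [parity A true] are the Grassmann-even and -odd parts.
   All sums in the Borcherds identity have finitely many nonzero terms by
   [va_truncation]; the identity holds for all large enough cutoffs. *)
Record vertexAlgebra (C : numClosedFieldType) := VertexAlgebra {
  va_space :> lmodType C;
  parity : bool -> set va_space;
  vacuum : va_space;
  transl : va_space -> va_space;
  vprod : int -> va_space -> va_space -> va_space;
  va_parity : direct_decomposition parity;
  va_vacuum_even : parity false vacuum;
  va_vprod_parity : forall p r n x y,
    parity p x -> parity r y -> parity (p (+) r) (vprod n x y);
  va_transl_linear : linear transl;
  va_vprod_linear_r : forall n x, linear (vprod n x);
  va_vprod_linear_l : forall n y, linear (vprod n ^~ y);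
  va_truncation : forall x y,
    exists N : nat, forall n : nat, (N <= n)%N -> vprod n%:Z x y = 0;
  va_vacuum_field : forall n x, vprod n vacuum x = if n == -1 then x else 0;
  va_creation : forall (n : nat) x, vprod n%:Z x vacuum = 0;
  va_creation_state : forall x, vprod (-1) x vacuum = x;
  va_transl_vacuum : transl vacuum = 0;
  va_transl_covariance : forall n x y,
    transl (vprod n x y) - vprod n x (transl y) = - n%:~R *: vprod (n - 1) x y;
  va_borcherds : forall p r x y z (m n k : int),
    parity p x -> parity r y ->
    exists N0 : nat, forall N : nat, (N0 <= N)%N ->
      \sum_(j < N) binz C m j *: vprod (m + k - j%:Z) (vprod (n + j%:Z) x y) z
      = \sum_(j < N) ((-1) ^+ j * binz C n j) *:
          (vprod (m + n - j%:Z) x (vprod (k + j%:Z) y z)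
           - ((-1) ^ n * (-1) ^+ (p && r)) *:
               vprod (n + k - j%:Z) y (vprod (m + j%:Z) x z))
}.

Arguments parity {C} A : rename.
Arguments vacuum {C} A : rename.
Arguments transl {C} A : rename.
Arguments vprod {C} A : rename.

(* Conformal weights h, filtration degrees R and filtration indices p lie in
   (1/2)Z and are everywhere encoded by the integers 2h, 2R and 2p. *)

Section GradedUnitarity.
Variables (C : numClosedFieldType) (A : vertexAlgebra C) (T : A).

Definition virasoro (n : int) : A -> A := vprod A (n + 1) T.

Definition weight_space (h2 : int) : set A :=
  [set x | virasoro 0 x = (h2%:~R / 2) *: x].

Definition is_VOA : Prop :=
  [/\ parity A false T,
      exists c : C, forall (m n : int) (x : A),
        virasoro m (virasoro n x) - virasoro n (virasoro m x)
        = (m - n)%:~R *: virasoro (m + n) x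
          + (if m + n == 0 then c / 12 * (m ^+ 3 - m)%:~R else 0) *: x,
      virasoro (-1) =1 transl A,
      forall x, lspan [set y | exists h2, weight_space h2 y] x
    & (forall h2, exists s : seq A, weight_space h2 `<=` lspan [set` s]) /\
      (exists h0 : int, forall h2, h2 < h0 -> weight_space h2 `<=` [set 0])].

(* The second clause is the coefficient of z^(-n-1) in
   (Y(x,z)u,v) = (-1)^(|x||u|) (u, Y(e^(z L_1) (e^(i pi) z^(-2))^(L_0) x, 1/z) v)
   for x of weight h: there (e^(i pi) z^(-2))^(L_0) x = i^(2h) z^(-2h) x, and
   e^(z L_1) x is the polynomial \sum_(j < N) z^j / j! L_1^j x. *)
Definition invariant_form (form : {biscalar A}) : Prop :=
  (forall p r (h2 n : int) (N : nat) (x u v : A),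
     parity A p x -> parity A r u -> weight_space h2 x ->
     iter N (virasoro 1) x = 0 ->
     form (vprod A n x u) v =
     (-1) ^+ (p && r) * 'i ^ h2 *
       \sum_(j < N) (j`!)%:R^-1 *
          form u (vprod A (h2 - n - 2 - j%:Z) (iter j (virasoro 1) x) v)) /\
  (forall (m : int) (u v : A), m \in [:: -1; 0; 1] ->
     form (virasoro m u) v = form u (virasoro (- m) v)).

(* [Z false] is V^0 and [Z true] is V^(1/2). *)
Definition is_Z2_grading (Z : bool -> set A) : Prop :=
  [/\ direct_decomposition Z,
      Z false (vacuum A)
    & forall b c n x y, Z b x -> Z c y -> Z (b (+) c) (vprod A n x y)].

Definition half_integral_filtration (Z : bool -> set A) (F : int -> set A)
    : Prop :=
  is_Z2_grading Z /\
  [/\ forall k, subspace (F k) /\ F k `<=` Z (odd `|k|%N),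
      forall k, F k `<=` F (k + 2),
      forall b x, Z b x -> exists k, odd `|k|%N = b /\ F k x,
      F 0 (vacuum A)
    & forall j k n x y, F j x -> F k y -> F (j + k) (vprod A n x y)].

Definition good_filtration (F : int -> set A) : Prop :=
  forall j k (n : nat) x y, F j x -> F k y -> F (j + k - 2) (vprod A n%:Z x y).

Definition nondegenerate_filtration (form : {biscalar A}) (F : int -> set A)
    : Prop :=
  forall k, nondegenerate_on form (F k).

Definition bigraded_piece (form : {biscalar A}) (F : int -> set A)
    (h2 R2 : int) : set A :=
  [set x | [/\ F R2 x, weight_space h2 x
             & forall y, F (R2 - 2) y -> form x y = 0]].

(* The first clause says that the pieces V_(h,R) exhaust A, so that sigma is
   uniquely determined. *)
Definition degree_operator (form : {biscalar A}) (F : int -> set A)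
    (sigma : A -> A) : Prop :=
  [/\ forall x, lspan [set y | exists h2 R2, bigraded_piece form F h2 R2 y] x,
      linear sigma
    & forall h2 R2 x, bigraded_piece form F h2 R2 x -> sigma x = 'i ^ R2 *: x].

Definition conjugation (F : int -> set A) (rho : A -> A) : Prop :=
  [/\ antilinear rho /\ bijective rho,
      forall x, rho (transl A x) = transl A (rho x),
      rho (vacuum A) = vacuum A,
      forall p r n x y, parity A p x -> parity A r y ->
        rho (vprod A n x y) = (-1) ^+ (p && r) *: vprod A n (rho x) (rho y)
    & rho T = T /\ forall k x, F k (rho x) <-> F k x].

(* The last clause is rho \o sigma = sigma^-1 \o rho. *)
Definition quaternionic_structure (Z : bool -> set A) (F : int -> set A)
    (sigma rho : A -> A) : Prop :=
  [/\ conjugation F rho,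
      forall (b : bool) x, Z b x -> rho (rho x) = (-1) ^+ b *: x
    & bijective sigma /\ forall x, sigma (rho (sigma x)) = rho x].

Definition sigma_rho_form (form : {biscalar A}) (sigma rho : A -> A) (x y : A)
    : C := form (sigma (rho x)) y.

Definition positive_definite_hermitian (herm : A -> A -> C) : Prop :=
  (forall x y, herm x y = (herm y x)^*) /\
  (forall x, x != 0 -> 0 < herm x x).

Definition graded_unitary_VOA (form : {biscalar A}) (Z : bool -> set A)
    (F : int -> set A) (rho : A -> A) : Prop :=
  [/\ is_VOA,
      invariant_form form /\ nondegenerate_on form setT,
      [/\ half_integral_filtration Z F, good_filtration F
        & nondegenerate_filtration form F]
    & exists sigma : A -> A,
      [/\ degree_operator form F sigma,
          quaternionic_structure Z F sigma rho
        & positive_definite_hermitian (sigma_rho_form form sigma rho)]].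

End GradedUnitarity.

(* This matrix is unitary for a Darboux basis. On the generators rho o rho is
   multiplication by the matrix conj(Om) *m Om, which is -1 (the value of s)
   exactly when Om is unitary; it is not for, say, a Darboux basis rescaled by a
   constant of modulus different from 1. *)
Definition form_matrix (C : numClosedFieldType) (V : vectType C)
    (Omega : {skew_symmetric V}) (d : nat) (e : d.-tuple V) : 'M[C]_d :=
  \matrix_(a, b) Omega (tnth e a) (tnth e b).

Section SymplecticBoson.
Variables (C : numClosedFieldType) (A : vertexAlgebra C).
Variables (d : nat) (Om : 'M[C]_d) (q : 'I_d -> A).

(* The word [:: (a_1, n_1); ...; (a_l, n_l)] encodes
   q^(a_1)_(-n_1-1) ... q^(a_l)_(-n_l-1) |0>. *)
Definition sb_monomial (s : seq ('I_d * nat)) : A :=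
  foldr (fun w v => vprod A (- (w.2.+1)%:Z) (q w.1) v) (vacuum A) s.

(* Creation modes commute, so words matter up to permutation: free generation
   says that the monomials of pairwise non-permuted words form a basis. *)
Definition symplectic_boson : Prop :=
  [/\ forall a, parity A false (q a),
      forall a b (n m : int) v,
        vprod A n (q a) (vprod A m (q b) v) - vprod A m (q b) (vprod A n (q a) v)
        = (if n + m + 1 == 0 then invmx Om a b else 0) *: v,
      forall x, lspan (range sb_monomial) x
    & forall (ss : seq (seq ('I_d * nat))) (c : seq ('I_d * nat) -> C),
        pairwise (fun s t => ~~ perm_eq s t) ss ->
        \sum_(s <- ss) c s *: sb_monomial s = 0 ->
        {in ss, forall s, c s = 0}].

Definition sb_stress : A :=
  2^-1 *: \sum_(a < d) \sum_(b < d)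
     Om a b *: vprod A (-1) (q b) (transl A (q a)).

Definition sb_graded (l : int) : set A :=
  lspan [set x | exists s, (size s)%:Z = l /\ x = sb_monomial s].

Definition sb_filtration (k : int) : set A :=
  lspan [set x | exists j : nat, sb_graded (k - 2 * j%:Z) x].

Definition sb_Z2 (b : bool) : set A :=
  lspan [set x | exists s, odd (size s) = b /\ x = sb_monomial s].

(* The tuple b below runs over the summation indices (b_1, ..., b_l). *)
Definition sb_conjugation (rho : A -> A) : Prop :=
  antilinear rho /\
  forall s : seq ('I_d * nat),
    rho (sb_monomial s) =
    (-1) ^+ size s *: \sum_(b : (size s).-tuple 'I_d)
       (\prod_(w <- zip (unzip1 s) b) Om w.1 w.2) *:
         sb_monomial (zip b (unzip2 s)).

End SymplecticBoson.

(* Main.v *)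
Require Import Defs.
From mathcomp Require Import all_boot all_order all_algebra.
From mathcomp Require Import boolp classical_sets reals complex.
From mathcomp Require Import zify ring.

(** Write W for the inverse of the matrix Om, so that Om_ab W^bc = delta.
The relations [q^a_n, q^b_m] = W^ab delta_(n+m+1,0) present the algebra as a
bosonic Fock space: the modes q^a_(-n-1), n >= 0, create, and the operator
p^a_n = Om_ab q^b_n is the derivative with respect to q^a_(-n-1), because
[p^a_n, q^c_(-m-1)] = Om_ab W^bc delta_(n,m) ([lowering_monomial]).

Positivity.  Each q^a has weight 1/2 and is killed by L_1, so invariance reads
(q^a_n u, v) = i (u, q^a_(-n-1) v) ([form_q]).  The map J = sigma o rho sends
q^a to -i Om_ab q^b, and the two factors of i cancel: for the Hermitian form
<x|y> = (J x, y) the adjoint of q^a_(-n-1) is exactly p^a_n.  Hence monomials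
are orthogonal, and the square norm of a monomial is the product of the
factorials of the multiplicities of its letters ([form_J_monomials],
[J_positive]).

Filtration.  A creation mode adds a letter and an annihilation mode removes
one.  The Borcherds identity writes the modes of q^a_(-m-1) x through products
of modes of q^a and of x ([vprod_assoc]), so by induction on words x_n y has at
most as many letters as x and y together, and at least two fewer when n >= 0,
since at least one contraction then takes place ([filtration_vprod],
[sb_good_filtration]).  J maps every filtered piece onto itself, so positivity
gives nondegeneracy of the bilinear form on that piece.  As monomials of
different lengths are orthogonal, the piece orthogonal to lower degrees is
spanned by the monomials of one length, and sigma multiplies these by a power
of i ([sb_degree_operator]).

Quaternionic structure.  That rho respects the products reduces, by the same
induction on words, to its compatibility with the modes of q^a.  For creation
modes this is the definition of rho; for annihilation modes it says that the
commutators of the fields rho(q^a) are the conjugates of those of the q^a,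
which amounts to conj(W) = Om^T, the unitarity of Om ([rho_q_mode]).  The same
identity yields rho (rho q^a) = - q^a and rho T = T.

Conformal structure.  The operator product expansions of T with q^a and with
itself are computations with at most two contractions; they give the Virasoro
relations with central charge - d / 2 ([stress_stress],
[sb_virasoro_relations]) and show that monomials are weight vectors. *)

Set Implicit Arguments.
Unset Strict Implicit.
Unset Printing Implicit Defensive.

Import Order.TTheory GRing.Theory Num.Theory.

Local Open Scope classical_set_scope.
Local Open Scope ring_scope.

(** * Spans, subspaces and anti-linear maps *)

Section Subspaces.
Variables (C : numClosedFieldType) (A : lmodType C).
Implicit Types (P Q : set A) (x y : A).

Lemma subspace0 P : subspace P -> P 0.
Proof. by case. Qed.

Lemma subspaceZ P c x : subspace P -> P x -> P (c *: x).
Proof. by case=> P0 PZD Px; rewrite -[c *: x]addr0; exact: PZD. Qed.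

Lemma subspaceD P x y : subspace P -> P x -> P y -> P (x + y).
Proof. by case=> P0 PZD Px Py; rewrite -[x]scale1r; exact: PZD. Qed.

Lemma subspaceB P x y : subspace P -> P x -> P y -> P (x - y).
Proof.
by move=> sP Px Py; apply: subspaceD => //; rewrite -scaleN1r; exact: subspaceZ.
Qed.

Lemma subspace_sum P (I : Type) (r : seq I) (p : pred I) (f : I -> A) :
  subspace P -> (forall i, p i -> P (f i)) -> P (\sum_(i <- r | p i) f i).
Proof.
move=> sP Pf; apply: big_ind => //; first exact: subspace0.
by move=> x y; exact: subspaceD.
Qed.

Lemma mem_lspan P x : P x -> lspan P x.
Proof.
move=> Px; exists 1%N, (fun=> 1), (fun=> x); split=> //.
by rewrite big_ord1 scale1r.
Qed.

Lemma lspan_sub P Q : subspace Q -> P `<=` Q -> lspan P `<=` Q.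
Proof.
move=> sQ PQ _ [n [c [v [Pv ->]]]]; apply: subspace_sum => // i _.
by apply: subspaceZ => //; apply: PQ.
Qed.

Lemma subspace_lspan P : subspace (lspan P).
Proof.
split; first by exists 0%N, (fun=> 0), (fun=> 0); split; [case | rewrite big_ord0].
move=> a _ _ [n [c [v [Pv ->]]]] [m [c' [v' [Pv' ->]]]].
pose glue (T : Type) (f : 'I_n -> T) (g : 'I_m -> T) (i : 'I_(n + m)) :=
  match split i with inl j => f j | inr j => g j end.
exists (n + m)%N, (glue C (fun i => a * c i) c'), (glue _ v v').
split=> [i|]; first by rewrite /glue; case: (split i).
rewrite big_split_ord /= scaler_sumr.
congr (_ + _); apply: eq_bigr => i _; rewrite /glue.
  by rewrite (unsplitK (inl i)) scalerA.
by rewrite (unsplitK (inr i)).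
Qed.

Lemma lspan_mono P Q : P `<=` Q -> lspan P `<=` lspan Q.
Proof.
move=> PQ; apply: lspan_sub; first exact: subspace_lspan.
by move=> x /PQ; exact: mem_lspan.
Qed.

Lemma subspace_antilinear (f : A -> A) P :
  antilinear f -> subspace P -> subspace [set x | P (f x)].
Proof.
move=> fZD [P0 PZD]; split=> [|c x y /= Px Py]; last by rewrite fZD; apply: PZD.
have := fZD 1 0 0; rewrite scaler0 addr0 rmorph1 scale1r /= => f0.
suff -> : f 0 = 0 by [].
by apply: (addIr (f 0)); rewrite add0r -f0.
Qed.

Section Antilinear.
Variables (f : A -> A) (fZD : antilinear f).

Lemma antilinear0 : f 0 = 0.
Proof.
have := fZD 1 0 0; rewrite scaler0 addr0 rmorph1 scale1r => f0.
by apply: (addIr (f 0)); rewrite add0r -f0.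
Qed.

Lemma antilinearD x y : f (x + y) = f x + f y.
Proof. by rewrite -[x in LHS]scale1r fZD rmorph1 scale1r. Qed.

Lemma antilinearZ c x : f (c *: x) = c^* *: f x.
Proof. by rewrite -[c *: x]addr0 fZD antilinear0 addr0. Qed.

Lemma antilinearB x y : f (x - y) = f x - f y.
Proof. by rewrite -scaleN1r antilinearD antilinearZ rmorphN1 scaleN1r. Qed.

Lemma antilinear_sum (I : Type) (r : seq I) (p : pred I) (g : I -> A) :
  f (\sum_(i <- r | p i) g i) = \sum_(i <- r | p i) f (g i).
Proof. by apply: (big_morph f antilinearD antilinear0). Qed.

End Antilinear.
End Subspaces.

(** * Consequences of the Borcherds identity *)

Section VertexAlgebra.
Variables (C : numClosedFieldType) (A : vertexAlgebra C).
Implicit Types (x y z : A) (m n k : int).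

Lemma vprodDr n x y z : vprod A n x (y + z) = vprod A n x y + vprod A n x z.
Proof. by rewrite -[y in LHS]scale1r va_vprod_linear_r scale1r. Qed.

Lemma vprod0r n x : vprod A n x 0 = 0.
Proof. by apply: (addIr (vprod A n x 0)); rewrite -vprodDr !add0r. Qed.

Lemma vprodZr n x c y : vprod A n x (c *: y) = c *: vprod A n x y.
Proof. by rewrite -[c *: y]addr0 va_vprod_linear_r vprod0r addr0. Qed.

Lemma vprodNr n x y : vprod A n x (- y) = - vprod A n x y.
Proof. by rewrite -!scaleN1r vprodZr. Qed.

Lemma vprod_sumr n x (I : Type) (r : seq I) (p : pred I) (f : I -> A) :
  vprod A n x (\sum_(i <- r | p i) f i) = \sum_(i <- r | p i) vprod A n x (f i).
Proof. by apply: (big_morph _ (vprodDr n x) (vprod0r n x)). Qed.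

Lemma vprodDl n x y z : vprod A n (x + y) z = vprod A n x z + vprod A n y z.
Proof.
by rewrite -[x in LHS]scale1r (va_vprod_linear_l n z) /= scale1r.
Qed.

Lemma vprod0l n z : vprod A n 0 z = 0.
Proof. by apply: (addIr (vprod A n 0 z)); rewrite -vprodDl !add0r. Qed.

Lemma vprodZl n c x z : vprod A n (c *: x) z = c *: vprod A n x z.
Proof. by rewrite -[c *: x]addr0 (va_vprod_linear_l n z) /= vprod0l addr0. Qed.

Lemma vprod_suml n z (I : Type) (r : seq I) (p : pred I) (f : I -> A) :
  vprod A n (\sum_(i <- r | p i) f i) z = \sum_(i <- r | p i) vprod A n (f i) z.
Proof.
by apply: (big_morph (vprod A n ^~ z) (fun x y => vprodDl n x y z) (vprod0l n z)).
Qed.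

Lemma subspace_vprod n x (P : set A) :
  subspace P -> subspace [set y | P (vprod A n x y)].
Proof.
move=> [P0 PZD]; split=> [|c y z] /=; first by rewrite vprod0r.
by move=> Py Pz; rewrite vprodDr vprodZr; exact: PZD.
Qed.

Lemma subspace_vprodl n y (P : set A) :
  subspace P -> subspace [set x | P (vprod A n x y)].
Proof.
move=> [P0 PZD]; split=> [|c x z] /=; first by rewrite vprod0l.
by move=> Px Pz; rewrite vprodDl vprodZl; exact: PZD.
Qed.

Lemma translD x y : transl A (x + y) = transl A x + transl A y.
Proof. by rewrite -[x in LHS]scale1r va_transl_linear scale1r. Qed.

Lemma transl0 : transl A 0 = 0.
Proof. by apply: (addIr (transl A 0)); rewrite -translD !add0r. Qed.

Lemma translZ c x : transl A (c *: x) = c *: transl A x.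
Proof. by rewrite -[c *: x]addr0 va_transl_linear transl0 addr0. Qed.

Lemma transl_sum (I : Type) (r : seq I) (p : pred I) (f : I -> A) :
  transl A (\sum_(i <- r | p i) f i) = \sum_(i <- r | p i) transl A (f i).
Proof. by apply: (big_morph _ translD transl0). Qed.

Lemma transl_vprod n x y :
  transl A (vprod A n x y) = vprod A n x (transl A y) - n%:~R *: vprod A (n - 1) x y.
Proof. by apply/eqP; rewrite addrC -scaleNr -subr_eq va_transl_covariance. Qed.

Lemma translE x : transl A x = vprod A (- 2%:Z) x (vacuum A).
Proof.
rewrite -[x in LHS]va_creation_state transl_vprod va_transl_vacuum vprod0r.
by rewrite add0r -scaleNr rmorphN1 opprK scale1r.
Qed.

Lemma subspace_parity b : subspace (parity A b).
Proof. by case: (va_parity A). Qed.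

Lemma binz0 (m : int) : binz C m 0 = 1.
Proof. by rewrite /binz big_ord0 divr1. Qed.

Lemma binz0n j : binz C 0 j.+1 = 0.
Proof. by rewrite /binz big_ord_recl /= subr0 !mul0r. Qed.

(** The case n = 0 of the Borcherds identity, where the right-hand side collapses
to its first term. *)
Lemma mode_commutator b x y z m k : parity A false x -> parity A b y ->
  exists N0 : nat, forall N : nat, (N0 <= N)%N ->
    vprod A m x (vprod A k y z) - vprod A k y (vprod A m x z) =
    \sum_(j < N) binz C m j *: vprod A (m + k - j%:Z) (vprod A j%:Z x y) z.
Proof.
move=> px py; have [N0 hN] := va_borcherds z m 0 k px py.
exists N0.+1 => -[|N] // leN; have := hN N.+1 (leqW leN).
under eq_bigr do rewrite add0r; move=> ->.
rewrite big_ord_recl big1 => [|j _]; last by rewrite /= binz0n mulr0 scale0r.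
by rewrite /= !binz0 mulr1 expr0 !scale1r !addr0 add0r.
Qed.

(** The case m = 0 of the Borcherds identity.  It drives every induction on words
below: the modes of x_n y are reduced to those of x and of y. *)
Lemma vprod_assoc b x y z n k : parity A false x -> parity A b y ->
  exists N0 : nat, forall N : nat, (N0 <= N)%N ->
    vprod A k (vprod A n x y) z =
    \sum_(j < N) ((-1) ^+ j * binz C n j) *:
       (vprod A (n - j%:Z) x (vprod A (k + j%:Z) y z)
        - (-1) ^ n *: vprod A (n + k - j%:Z) y (vprod A j%:Z x z)).
Proof.
move=> px py; have [N0 hN] := va_borcherds z 0 n k px py.
exists N0.+1 => -[|N] // leN; have := hN N.+1 (leqW leN).
rewrite big_ord_recl big1 => [|j _]; last by rewrite /= binz0n scale0r.
rewrite /= binz0 scale1r add0r subr0 !addr0 => ->.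
by apply: eq_bigr => j _; rewrite !add0r mulr1.
Qed.

Lemma binzN2 j : (-1) ^+ j * binz C (- 2%:Z) j = j.+1%:R.
Proof.
rewrite /binz; suff -> : \prod_(i < j) ((- 2%:Z)%:~R - i%:R) = (-1) ^+ j * (j.+1)`!%:R :> C.
  rewrite !mulrA -exprD addnn -signr_odd odd_double mul1r factS natrM mulfK //.
  by rewrite pnatr_eq0 -lt0n fact_gt0.
elim: j => [|j IH]; first by rewrite big_ord0 mul1r.
rewrite big_ord_recr /= IH.
have -> : (- 2%:Z)%:~R - j%:R = - j.+2%:R :> C.
  by rewrite rmorphN /= -!pmulrn -opprD -natrD add2n.
by rewrite [in RHS]factS [in RHS]natrM exprS; ring.
Qed.

(** The translate is x_(-2)|0>, and in the associativity formula for it the vacuum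
field has a single nonzero mode: at most one term survives, from the first
group when k < 0 and from the second when k > 0. *)
Lemma vprod_transl k x z : parity A false x ->
  vprod A k (transl A x) z = - k%:~R *: vprod A (k - 1) x z.
Proof.
move=> px; rewrite translE.
have [N0 hN] := vprod_assoc z (- 2%:Z) k px (va_vacuum_even A).
rewrite (hN (N0 + `|k|.+1)%N (leq_addr _ _)).
under eq_bigr => j _ do rewrite binzN2 !va_vacuum_field.
have E2 : (-1) ^ (- 2%:Z) = 1 :> C by rewrite -exprnN sqrrN expr1n invr1.
pose f (j : nat) := j.+1%:R *:
  (vprod A (- 2%:Z - j%:Z) x (if k + j%:Z == -1 then z else 0) -
     (-1) ^ (- 2%:Z) *: (if - 2%:Z + k - j%:Z == -1 then vprod A j%:Z x z else 0)).
have E j : (k + j%:Z == -1) = false -> (- 2%:Z + k - j%:Z == -1) = false -> f j = 0.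
  by rewrite /f => -> ->; rewrite vprod0r scaler0 subr0 scaler0.
have El j : (k + j%:Z == -1) = true -> (- 2%:Z + k - j%:Z == -1) = false ->
    f j = j.+1%:R *: vprod A (- 2%:Z - j%:Z) x z.
  by rewrite /f => -> ->; rewrite scaler0 subr0.
have Er j : (k + j%:Z == -1) = false -> (- 2%:Z + k - j%:Z == -1) = true ->
    f j = - j.+1%:R *: vprod A j%:Z x z.
  by rewrite /f => -> ->; rewrite vprod0r sub0r E2 scale1r scalerN scaleNr.
rewrite -[LHS]/(\sum_(j < _) f j).
have single i : (i < N0 + `|k|.+1)%N -> (forall j, j <> i -> f j = 0) ->
    \sum_(j < N0 + `|k|.+1) f j = f i.
  move=> iN f0; rewrite (bigD1 (Ordinal iN)) //= big1 ?addr0 // => j /eqP ji.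
  by apply: f0 => e; apply: ji; apply: val_inj.
case: k @f hN E El Er single => [[|k]|k] f _ E El Er single.
- by rewrite oppr0 scale0r big1 // => j _; apply: E; apply/eqP; lia.
- rewrite (single k) => [||j jk]; [|lia|by apply: E; apply/eqP; lia].
  by rewrite Er; [congr (_ *: vprod A _ _ _); lia|lia|lia].
- rewrite (single k) => [||j jk]; [|lia|by apply: E; apply/eqP; lia].
  rewrite El; [|lia|lia]; rewrite NegzE rmorphN opprK.
  by congr (_ *: vprod A _ _ _); lia.
Qed.

End VertexAlgebra.

(** * The Fock space of the symplectic bosons *)

Section FockSpace.
Variables (C : numClosedFieldType) (A : vertexAlgebra C).
Variables (d : nat) (Om : 'M[C]_d) (q : 'I_d -> A).
Hypothesis hq : symplectic_boson Om q.

Local Notation word := (seq ('I_d * nat)).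
Local Notation mono := (sb_monomial q).
Local Notation vac := (vacuum A).

Lemma q_even a : parity A false (q a).
Proof. by case: hq. Qed.

Lemma q_commutator a b n m v :
  vprod A n (q a) (vprod A m (q b) v) =
  vprod A m (q b) (vprod A n (q a) v)
  + (if n + m + 1 == 0 then invmx Om a b else 0) *: v.
Proof. by case: hq => _ h _ _; rewrite -h addrC subrK. Qed.

Lemma q_creation_commute a b (n m : nat) v :
  vprod A (- n.+1%:Z) (q a) (vprod A (- m.+1%:Z) (q b) v) =
  vprod A (- m.+1%:Z) (q b) (vprod A (- n.+1%:Z) (q a) v).
Proof. by rewrite q_commutator /= scale0r addr0. Qed.

Lemma sb_monomial_ind (P : set A) :
  subspace P -> (forall s, P (mono s)) -> forall x, P x.
Proof.
move=> sP Pm x; case: hq => _ _ h _.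
by apply: (lspan_sub sP _ (h x)) => _ [s _ <-]; exact: Pm.
Qed.

Lemma fock_ind (P : set A) : subspace P -> P vac ->
  (forall a (n : nat) s, P (mono s) -> P (vprod A (- n.+1%:Z) (q a) (mono s))) ->
  forall x, P x.
Proof.
move=> sP P0 Pq; apply: sb_monomial_ind => // s.
by elim: s => [|[a n] s IH] //=; exact: Pq.
Qed.

Lemma even_sb x : parity A false x.
Proof.
move: x; apply: fock_ind => [||a n s ps]; first exact: subspace_parity.
- exact: va_vacuum_even.
- by apply: (@va_vprod_parity _ _ false false) => //; exact: q_even.
Qed.

(** Generated by even fields, the algebra has no odd part, so all signs coming
from Grassmann parity are trivial. *)
Lemma odd_sb x : parity A true x -> x = 0.
Proof. by move=> px; case: (va_parity A) => _ _; apply => //; exact: even_sb. Qed.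

Lemma sb_monomial_rcons_front w s1 s2 : mono (s1 ++ w :: s2) = mono (w :: s1 ++ s2).
Proof.
elim: s1 => //= w' s1 ->.
by rewrite /= q_creation_commute.
Qed.

Lemma perm_sb_monomial s t : perm_eq s t -> mono s = mono t.
Proof.
elim: s t => [|w s IH] t; first by rewrite perm_sym => /perm_nilP ->.
move=> st; have wt : w \in t by rewrite -(perm_mem st) mem_head.
case/splitPr: wt st => t1 t2; rewrite -[w :: t2]cat1s.
rewrite perm_sym perm_catCA /= perm_cons perm_sym.
by move=> /IH; rewrite sb_monomial_rcons_front /= => ->.
Qed.

(** A normal form of words up to permutation; any total order on letters would
do. *)
Definition canonical_word : word -> word :=
  sort (fun a b => (pickle a <= pickle b)%N).

Lemma perm_canonical_word s : perm_eq (canonical_word s) s.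
Proof. by rewrite /canonical_word perm_sort. Qed.

Lemma canonical_wordP s t : reflect (canonical_word s = canonical_word t) (perm_eq s t).
Proof.
apply: perm_sortP => [a b|b a c|a b /andP[ab ba]]; first exact: leq_total.
  exact: leq_trans.
by apply: (pcan_inj pickleK); apply/eqP; rewrite eqn_leq ab ba.
Qed.

Lemma canonical_wordK s : canonical_word (canonical_word s) = canonical_word s.
Proof. by apply/canonical_wordP; exact: perm_canonical_word. Qed.

Definition canonical_support (l : seq (C * word)) : seq word :=
  undup [seq canonical_word p.2 | p <- l].

Definition collected_coef (l : seq (C * word)) (t : word) : C :=
  \sum_(p <- l | canonical_word p.2 == t) p.1.

Definition nonpermuted (ss : seq word) : Prop :=
  uniq ss /\ {in ss &, forall s t, perm_eq s t -> s = t}.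

Lemma canonical_support_nonpermuted l : nonpermuted (canonical_support l).
Proof.
split=> [|s t]; first exact: undup_uniq.
rewrite !mem_undup => /mapP[p _ ->] /mapP[p' _ ->] /canonical_wordP.
by rewrite !canonical_wordK.
Qed.

(** Merges the terms whose words are permutations of each other.  The factor lam
lets one regrouping serve both a vector and its image under an operator that is
diagonal on monomials. *)
Lemma collect_words (lam : word -> C) (l : seq (C * word)) :
  (forall s t, perm_eq s t -> lam s = lam t) ->
  \sum_(p <- l) (lam p.2 * p.1) *: mono p.2 =
  \sum_(t <- canonical_support l) (lam t * collected_coef l t) *: mono t.
Proof.
move=> lamP.
transitivity (\sum_(p <- l) \sum_(t <- canonical_support l | canonical_word p.2 == t)
   (lam p.2 * p.1) *: mono p.2).
  rewrite !big_seq; apply: eq_bigr => p pl.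
  rewrite (eq_bigl (pred1 (canonical_word p.2))) => [|t]; last by rewrite /= eq_sym.
  rewrite -big_filter filter_pred1_uniq ?undup_uniq ?big_seq1 // mem_undup.
  by rewrite (map_f (fun p => canonical_word p.2)).
rewrite (exchange_big_dep xpredT) //=; apply: eq_bigr => t _.
rewrite /collected_coef mulr_sumr scaler_suml; apply: eq_bigr => p /eqP <-.
have e := perm_canonical_word p.2.
by rewrite (perm_sb_monomial e) (lamP _ _ e).
Qed.

Lemma sb_expansion x : exists l : seq (C * word), x = \sum_(p <- l) p.1 *: mono p.2.
Proof.
move: x; apply: sb_monomial_ind => [|s]; last first.
  by exists [:: (1, s)]; rewrite big_seq1 scale1r.
split; first by exists [::]; rewrite big_nil.
move=> c _ _ [l ->] [l' ->]; exists ([seq (c * p.1, p.2) | p <- l] ++ l').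
rewrite big_cat big_map scaler_sumr; congr (_ + _).
by apply: eq_bigr => p _; rewrite scalerA.
Qed.

Lemma sb_canonical_expansion x : exists (ss : seq word) (c : word -> C),
  nonpermuted ss /\ x = \sum_(s <- ss) c s *: mono s.
Proof.
have [l ->] := sb_expansion x; exists (canonical_support l), (collected_coef l).
split; first exact: canonical_support_nonpermuted.
transitivity (\sum_(p <- l) (1 * p.1) *: mono p.2).
  by apply: eq_bigr => p _; rewrite mul1r.
rewrite (collect_words (lam := fun=> 1)) //.
by apply: eq_bigr => t _; rewrite mul1r.
Qed.

Lemma sb_free (ss : seq word) (c : word -> C) :
  nonpermuted ss ->
  \sum_(s <- ss) c s *: mono s = 0 -> {in ss, forall s, c s = 0}.
Proof.
case=> ssU ssP; case: hq => _ _ _; apply; rewrite uniq_pairwise in ssU.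
have ssA : all (mem ss) ss by apply/allP.
apply: sub_in_pairwise ssA ssU => s t s_ss t_ss.
by apply: contra => /(ssP _ _ s_ss t_ss) ->.
Qed.

(** Eigenvalues on monomials extend to a linear operator.  An expansion of each
vector is chosen; free generation makes the result independent of the choice,
once the terms with permuted words have been collected. *)
Lemma diagonal_operator (lam : word -> C) :
  (forall s t, perm_eq s t -> lam s = lam t) ->
  exists f : A -> A, linear f /\ forall s, f (mono s) = lam s *: mono s.
Proof.
move=> lamP; have [L LP] := choice sb_expansion.
pose lsum (l : seq (C * word)) := \sum_(p <- l) (lam p.2 * p.1) *: mono p.2.
have lsum0 l : \sum_(p <- l) p.1 *: mono p.2 = 0 -> lsum l = 0.
  move=> l0; rewrite /lsum collect_words // big_seq big1 // => t tl.
  rewrite (_ : collected_coef l t = 0) ?mulr0 ?scale0r //.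
  apply: sb_free tl; first exact: canonical_support_nonpermuted.
  rewrite -[RHS]l0; transitivity (\sum_(p <- l) (1 * p.1) *: mono p.2).
    by rewrite (collect_words (lam := fun=> 1)) //; apply: eq_bigr => s _; rewrite mul1r.
  by apply: eq_bigr => p _; rewrite mul1r.
pose sc c (l : seq (C * word)) := [seq (c * p.1, p.2) | p <- l].
have sc1 c l : \sum_(p <- sc c l) p.1 *: mono p.2 = c *: \sum_(p <- l) p.1 *: mono p.2.
  by rewrite big_map scaler_sumr; apply: eq_bigr => p _; rewrite scalerA.
have sc2 c l : lsum (sc c l) = c *: lsum l.
  rewrite /lsum big_map scaler_sumr; apply: eq_bigr => p _.
  by rewrite scalerA; congr (_ *: _); rewrite mulrCA.
have lsumD l l' : lsum (l ++ l') = lsum l + lsum l' by rewrite /lsum big_cat.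
exists (fun x => lsum (L x)); split=> [c x y|s]; apply/eqP; rewrite -subr_eq0.
  rewrite -sc2 -lsumD -scaleN1r -sc2 -lsumD; apply/eqP/lsum0.
  by rewrite big_cat sc1 big_cat sc1 /= -!LP scaleN1r subrr.
have -> : lam s *: mono s = lsum [:: (1, s)] by rewrite /lsum big_seq1 mulr1.
rewrite -scaleN1r -sc2 -lsumD; apply/eqP/lsum0.
by rewrite big_cat sc1 big_seq1 /= -LP scale1r scaleN1r subrr.
Qed.

Lemma eq_on_fock (f g : A -> A) : linear f -> linear g -> f vac = g vac ->
  (forall a (n : nat) x, f x = g x ->
     f (vprod A (- n.+1%:Z) (q a) x) = g (vprod A (- n.+1%:Z) (q a) x)) ->
  f =1 g.
Proof.
move=> fL gL fg0 fgq; apply: fock_ind => // [|a n s]; last exact: fgq.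
have lin0 (h : A -> A) : linear h -> h 0 = 0.
  move=> hL; have := hL 1 0 0; rewrite scaler0 addr0 scale1r => h0.
  by apply: (addIr (h 0)); rewrite add0r -h0.
by split=> [|c x y /= fgx fgy]; rewrite ?(lin0 f) ?(lin0 g) // fL gL fgx fgy.
Qed.

End FockSpace.

(** * Operator product expansions with the stress tensor *)

Section Virasoro.
Variables (C : numClosedFieldType) (A : vertexAlgebra C).
Variables (d : nat) (Om : 'M[C]_d) (q : 'I_d -> A).
Hypotheses (hq : symplectic_boson Om q) (Om_unit : Om \in unitmx).
Hypothesis (Om_skew : forall a b, Om a b = - Om b a).

Local Notation word := (seq ('I_d * nat)).
Local Notation mono := (sb_monomial q).
Local Notation vac := (vacuum A).
Local Notation W := (invmx Om).
Local Notation T := (sb_stress Om q).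

Lemma sum_invmx_mul a c : \sum_b W a b * Om b c = (a == c)%:R.
Proof. by have := mulVmx Om_unit => /matrixP/(_ a c); rewrite !mxE => <-. Qed.

Lemma sum_mul_invmx a c : \sum_b Om a b * W b c = (a == c)%:R.
Proof. by have := mulmxV Om_unit => /matrixP/(_ a c); rewrite !mxE => <-. Qed.

Lemma invmx_skew a b : W a b = - W b a.
Proof.
have OmT : Om^T = - Om by apply/matrixP => i j; rewrite !mxE.
suff /matrixP/(_ a b) : W = - W^T by rewrite !mxE.
rewrite -[W^T](mulmxK Om_unit) -[X in W^T *m X]opprK -OmT mulmxN -trmx_mul.
by rewrite mulmxV // trmx1 mulNmx mul1mx opprK.
Qed.

Lemma delta_sum (f : 'I_d -> A) a : \sum_b (a == b)%:R *: f b = f a.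
Proof.
rewrite (bigD1 a) //= eqxx scale1r big1 ?addr0 // => b.
by rewrite eq_sym => /negbTE ->; rewrite scale0r.
Qed.

Lemma contract_invmx_mul (f : 'I_d -> A) a :
  \sum_b \sum_c Om b c *: (W a b *: f c) = f a.
Proof.
rewrite exchange_big -[RHS]delta_sum; apply: eq_bigr => c _.
rewrite -sum_invmx_mul scaler_suml; apply: eq_bigr => b _.
by rewrite scalerA mulrC.
Qed.

Lemma contract_mul_invmx (f : 'I_d -> A) a :
  \sum_b \sum_c Om b c *: (W a c *: f b) = - f a.
Proof.
rewrite -[in RHS]contract_invmx_mul exchange_big -sumrN; apply: eq_bigr => b _.
rewrite -sumrN; apply: eq_bigr => c _.
by rewrite Om_skew scaleNr.
Qed.

Lemma stressE : T = 2^-1 *: \sum_a \sum_b Om a b *: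
  vprod A (-1) (q b) (vprod A (- 2%:Z) (q a) vac).
Proof.
by congr (_ *: _); apply: eq_bigr => a _; apply: eq_bigr => b _; rewrite translE.
Qed.

(** T is quadratic, so q^c_j T is a sum of single contractions: one with the
undifferentiated factor (pole of order 1) and one with the differentiated factor
(pole of order 2). *)
Lemma q_stress c (j : nat) : vprod A j%:Z (q c) T =
  if j == 0 then - 2^-1 *: transl A (q c) else
  if j == 1 then 2^-1 *: q c else 0.
Proof.
have E : vprod A j%:Z (q c) T = 2^-1 *: \sum_a \sum_b Om a b *:
    ((if j == 1 then W c a else 0) *: q b
     + (if j == 0 then W c b else 0) *: transl A (q a)).
  rewrite vprodZr vprod_sumr; congr (_ *: _); apply: eq_bigr => a _.
  rewrite vprod_sumr; apply: eq_bigr => b _; rewrite vprodZr; congr (_ *: _).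
  rewrite (q_commutator hq) translE; congr (_ + _ *: _); last first.
    by congr (if _ then _ else _); lia.
  rewrite (q_commutator hq c a) va_creation vprod0r add0r vprodZr va_creation_state.
  by congr (_ *: _); congr (if _ then _ else _); lia.
case: j E => [|[|j]] -> /=.
- under eq_bigr => a _ do under eq_bigr => b _ do rewrite scale0r add0r.
  by rewrite contract_mul_invmx scalerN scaleNr.
- under eq_bigr => a _ do under eq_bigr => b _ do rewrite scale0r addr0.
  by rewrite contract_invmx_mul.
- rewrite big1 ?scaler0 // => a _; rewrite big1 // => b _.
  by rewrite !scale0r addr0 scaler0.
Qed.

Lemma even_stress : parity A false T.
Proof. exact: even_sb hq _. Qed.

(** As T_k = L_(k-1), this is the commutator of a Virasoro mode with a primary field
of weight 1/2.  It is read off from the expansion of q^c with T, in which only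
two terms are nonzero. *)
Lemma stress_q_commutator c (k m : int) v :
  vprod A k T (vprod A m (q c) v) =
  vprod A m (q c) (vprod A k T v)
  - (m%:~R + k%:~R / 2) *: vprod A (m + k - 1) (q c) v.
Proof.
have := q_stress c; have := even_stress; move: T => S eS qS.
have [N0 /(_ N0.+2 (leq_addl 2 _))] := mode_commutator v m k (q_even hq c) eS.
rewrite !big_ord_recl big1 => [|j _]; last by rewrite /= qS /= vprod0l scaler0.
rewrite /= !qS /= binz0 scale1r !vprodZl (vprod_transl _ _ (q_even hq c)).
rewrite subr0 addr0 => /eqP; rewrite subr_eq => /eqP ->.
have -> : binz C m 1 = m%:~R by rewrite /binz big_ord1 subr0 divr1.
rewrite (_ : (bump 0 0)%:Z = 1) // !scalerA -scalerDl addrAC -scalerBl.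
rewrite (_ : _ - _ = 0) ?scale0r ?add0r //.
by rewrite intrD; field.
Qed.

Lemma virasoroN1E : virasoro T (-1) =1 transl A.
Proof.
apply: (eq_on_fock hq); [exact: va_vprod_linear_r|exact: va_transl_linear| |].
  by rewrite /virasoro va_creation va_transl_vacuum.
move=> a n x; rewrite /virasoro stress_q_commutator transl_vprod => ->.
by rewrite mul0r !addr0.
Qed.

(** Weight 2 and central charge - d / 2: the quartic pole is the double contraction,
which is proportional to Om_ab W^ba = d.  The cubic pole vanishes because it
contracts the skew matrix Om with commuting creation modes. *)
Lemma stress_stress (j : nat) : vprod A j%:Z T T =
  if j == 0 then transl A T else
  if j == 1 then 2 *: T else
  if j == 3 then - (d%:R / 4) *: vac else 0.
Proof.
have two0 : 2 != 0 :> C by rewrite pnatr_eq0.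
case: j => [|j]; first exact: virasoroN1E.
have -> : vprod A j.+1%:Z T T = 2^-1 *: \sum_a \sum_b Om a b *:
    ((2 - j.+1%:R / 2) *: vprod A (-1) (q b) (vprod A (j.+1%:Z - 3%:Z) (q a) vac)
     + (1 - j.+1%:R / 2) *: vprod A (j.+1%:Z - 2%:Z) (q b) (vprod A (- 2%:Z) (q a) vac)).
  rewrite [in X in vprod A _ _ X = _]stressE vprodZr vprod_sumr; congr (_ *: _).
  apply: eq_bigr => a _; rewrite vprod_sumr; apply: eq_bigr => b _.
  rewrite vprodZr; congr (_ *: _); rewrite stress_q_commutator.
  rewrite stress_q_commutator va_creation vprod0r add0r vprodNr vprodZr -!scaleNr.
  by congr (_ *: vprod A _ _ (vprod A _ _ _) + _ *: vprod A _ _ _);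
    try lia; rewrite opprD -!rmorphN.
case: j => [|[|[|j]]] /=.
- rewrite stressE [RHS]scalerA [2 * _]mulrC -[RHS]scalerA; congr (_ *: _).
  rewrite scaler_sumr; apply: eq_bigr => a _; rewrite scaler_sumr; apply: eq_bigr => b _.
  by rewrite -scalerDl !scalerA; congr (_ *: _); field.
- set S := \sum_a _; suff : S = - S.
    move/eqP; rewrite -addr_eq0 -mulr2n -scaler_nat scaler_eq0 (negPf two0) /=.
    by move/eqP => ->; rewrite scaler0.
  rewrite {1}/S exchange_big -sumrN; apply: eq_bigr => a _.
  rewrite -sumrN; apply: eq_bigr => b _; rewrite Om_skew scaleNr; congr (- (_ *: _)).
  rewrite divff // subrr !scale0r !addr0 (q_creation_commute hq a b 0 0) //.
- transitivity (2^-1 *: \sum_a \sum_b (Om a b * W b a) *: (- 2^-1 *: vac)).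
    congr (_ *: _); apply: eq_bigr => a _; apply: eq_bigr => b _.
    rewrite va_creation vprod0r scaler0 add0r (q_commutator hq) va_creation vprod0r add0r.
    rewrite -scalerA; congr (_ *: _); rewrite !scalerA mulrC; congr (_ *: _).
    by congr (_ * _); field.
  under eq_bigr => a _ do rewrite -scaler_suml sum_mul_invmx eqxx scale1r.
  rewrite sumr_const card_ord -scaler_nat !scalerA; congr (_ *: _).
  have four0 : 4 != 0 :> C by rewrite pnatr_eq0.
  by field.
- rewrite big1 ?scaler0 // => a _; rewrite big1 // => b _.
  rewrite va_creation vprod0r scaler0 add0r (q_commutator hq) va_creation vprod0r add0r.
  rewrite (_ : _ + 1 == 0 = false) ?scale0r ?scaler0 //.
  by apply/eqP; lia.
Qed.
End Virasoro.

(** * The conformal vertex algebra structure *)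

Section VOA.
Variables (C : numClosedFieldType) (A : vertexAlgebra C).
Variables (d : nat) (Om : 'M[C]_d) (q : 'I_d -> A).
Hypotheses (hq : symplectic_boson Om q) (Om_unit : Om \in unitmx).
Hypothesis (Om_skew : forall a b, Om a b = - Om b a).

Local Notation word := (seq ('I_d * nat)).
Local Notation mono := (sb_monomial q).
Local Notation vac := (vacuum A).
Local Notation T := (sb_stress Om q).

(** In the commutator formula only T_0 T = transl T, T_1 T = 2 T and T_3 T
contribute; the last one brings the binomial coefficient (m+1) m (m-1) / 6. *)
Lemma sb_virasoro_relations (m n : int) (x : A) :
  virasoro T m (virasoro T n x) - virasoro T n (virasoro T m x) =
  (m - n)%:~R *: virasoro T (m + n) x
  + (if m + n == 0 then - (d%:R / 2) / 12 * (m ^+ 3 - m)%:~R else 0) *: x.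
Proof.
rewrite /virasoro.
have := stress_stress hq Om_unit Om_skew; have := even_stress hq.
move: T => S eS SS.
have [N0 /(_ N0.+4 (leq_addl 4 _)) ->] := mode_commutator x (m + 1) (n + 1) eS eS.
rewrite 4!big_ord_recl big1 => [|j _]; last by rewrite /= SS /= vprod0l scaler0.
rewrite (_ : (ord0 : 'I_N0.+4) = 0%N :> nat) // !lift0 /= !SS /=.
rewrite binz0 scale1r !vprodZl (vprod_transl _ _ eS) vprod0l scaler0 add0r addr0.
rewrite va_vacuum_field.
have -> : binz C (m + 1) 1 = (m + 1)%:~R by rewrite /binz big_ord1 subr0 divr1.
have -> : binz C (m + 1) 3 = (m ^+ 3 - m)%:~R / 6.
  rewrite /binz 3!big_ord_recr big_ord0 /= mul1r subr0; congr (_ / _).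
  by rewrite rmorphB rmorphXn /= !intrD; ring.
rewrite addr0 addrA !scalerA (_ : m + 1 + (n + 1) - 1%N%:Z = m + n + 1); last by lia.
rewrite -scalerDl; congr (_ *: _ + _).
  by rewrite !intrD rmorphN /=; ring.
rewrite (_ : (_ == -1) = (m + n == 0)); last by lia.
case: ifP => _; last by rewrite scaler0 scale0r.
by congr (_ *: _); field; rewrite ?pnatr_eq0.
Qed.

(** Twice the conformal weight: the letter (a, n) stands for a creation mode of
weight n + 1/2. *)
Definition word_weight (s : word) : nat := \sum_(w <- s) (2 * w.2 + 1)%N.

Lemma virasoro0_monomial s :
  virasoro T 0 (mono s) = ((word_weight s)%:R / 2) *: mono s.
Proof.
elim: s => [|[a n] s IH].
  by rewrite /word_weight big_nil mul0r scale0r /virasoro va_creation.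
rewrite /= /virasoro (stress_q_commutator hq Om_unit Om_skew) -/(virasoro T 0 _) IH.
rewrite vprodZr addrK -scalerBl; congr (_ *: _).
rewrite /word_weight big_cons /= natrD rmorphN natrD natrM /= -pmulrn -(natr1 n).
by field.
Qed.

Lemma weight_space_monomial s : weight_space T (word_weight s) (mono s).
Proof. exact: virasoro0_monomial. Qed.

(** Monomials are eigenvectors of L_0 and the distinct ones are independent, so
only those with the right eigenvalue occur in a weight vector. *)
Lemma weight_space_support h2 (ss : seq word) (c : word -> C) :
  nonpermuted ss ->
  weight_space T h2 (\sum_(s <- ss) c s *: mono s) ->
  {in ss, forall s, c s != 0 -> (word_weight s)%:Z = h2}.
Proof.
move=> pss hx s sss cs0.
have := sb_free hq (c := fun s => c s * ((word_weight s)%:R / 2 - h2%:~R / 2)) pss.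
have -> : \sum_(t <- ss) (c t * ((word_weight t)%:R / 2 - h2%:~R / 2)) *: mono t = 0.
  move/eqP: hx; rewrite -subr_eq0 /virasoro vprod_sumr scaler_sumr -sumrB => /eqP hx0.
  apply: etrans hx0; apply: eq_bigr => t _.
  rewrite vprodZr -/(virasoro T 0 _) virasoro0_monomial.
  by rewrite !scalerA -scalerBl mulrBr [h2%:~R / 2 * _]mulrC.
move=> /(_ erefl _ sss) /eqP; rewrite mulf_eq0 (negPf cs0) -mulrBl mulf_eq0.
rewrite invr_eq0 pnatr_eq0 orbF subr_eq0 pmulrn eqr_int.
by move/eqP.
Qed.

Lemma weight_space_spanned h2 x : weight_space T h2 x ->
  lspan [set y | exists s, (word_weight s)%:Z = h2 /\ y = mono s] x.
Proof.
have [ss [c [pss ->]]] := sb_canonical_expansion hq x => hx.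
rewrite big_seq; apply: subspace_sum => [|s sss]; first exact: subspace_lspan.
have [->|cs0] := eqVneq (c s) 0.
  by rewrite scale0r; apply: subspace0; exact: subspace_lspan.
apply: subspaceZ; first exact: subspace_lspan.
by apply: mem_lspan; exists s; split=> //; exact: weight_space_support pss hx _ sss cs0.
Qed.

Lemma size_le_weight s : (size s <= word_weight s)%N.
Proof. by rewrite -sum1_size; apply: leq_sum => w _; rewrite addn1. Qed.

Lemma letter_lt_weight s w : w \in s -> (w.2 < word_weight s)%N.
Proof. by move=> ws; rewrite /word_weight (big_rem w) //=; lia. Qed.

(** A word of weight N has at most N letters, each of mode index below N. *)
Lemma finite_weight_space h2 : exists s : seq A, weight_space T h2 `<=` lspan [set` s].
Proof.
pose N := `|h2|%N.
pose words := [seq [seq (w.1, val w.2) | w <- val t]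
  | n <- iota 0 N.+1, t <- enum {: n.-tuple ('I_d * 'I_N)}].
exists [seq mono s | s <- words] => x /weight_space_spanned.
apply: lspan_mono => _ [s [hs ->]] /=; apply: map_f.
have hN : word_weight s = N by rewrite /N -hs.
have lt (w : 'I_d * nat) : w \in s -> (w.2 < N)%N by rewrite -hN; exact: letter_lt_weight.
have [t tE] : exists t : seq ('I_d * 'I_N), s = [seq (w.1, val w.2) | w <- t].
  elim: s lt {hs hN} => [|[a n] s IH] lt; first by exists [::].
  have [|t ->] := IH; first by move=> w ws; apply: lt; rewrite inE ws orbT.
  have nN : (n < N)%N by apply: (lt (a, n)); rewrite mem_head.
  by exists ((a, Ordinal nN) :: t).
apply/allpairsPdep; exists (size t), (in_tuple t).
split=> //; last by rewrite mem_enum.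
rewrite mem_iota /= add0n ltnS -(size_map (fun w => (w.1, val w.2)) t) -tE.
by apply: leq_trans (size_le_weight s) _; rewrite hN.
Qed.

Lemma sb_is_VOA : is_VOA T.
Proof.
split; first exact: even_stress hq.
- by exists (- (d%:R / 2)) => m n x; exact: sb_virasoro_relations.
- exact: virasoroN1E.
- apply: sb_monomial_ind hq _ (subspace_lspan _) _ => s.
  by apply: mem_lspan; exists (word_weight s)%:Z; exact: weight_space_monomial.
split; first exact: finite_weight_space.
exists 0 => h2 h2lt x /weight_space_spanned; apply: lspan_sub.
  by split=> [|c y z /= -> ->]; rewrite ?scaler0 ?addr0.
move=> y [s [hs _]]; by rewrite -hs in h2lt.
Qed.

End VOA.

(** * The filtration by half the number of letters *)

Section Filtration.
Variables (C : numClosedFieldType) (A : vertexAlgebra C).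
Variables (d : nat) (Om : 'M[C]_d) (q : 'I_d -> A).
Hypothesis hq : symplectic_boson Om q.

Local Notation word := (seq ('I_d * nat)).
Local Notation mono := (sb_monomial q).
Local Notation vac := (vacuum A).
Local Notation F := (sb_filtration q).
Local Notation Z := (sb_Z2 q).

Lemma sb_filtrationE k : F k =
  lspan [set y | exists s, (exists j : nat, (size s)%:Z = k - 2 * j%:Z) /\ y = mono s].
Proof.
apply/seteqP; split; apply: lspan_sub; try exact: subspace_lspan.
  move=> x [j]; apply: lspan_mono => _ [s [hs ->]].
  by exists s; split=> //; exists j.
by move=> _ [s [[j hs] ->]]; apply: mem_lspan; exists j; apply: mem_lspan; exists s.
Qed.

Lemma subspace_filtration k : subspace (F k).
Proof. exact: subspace_lspan. Qed.

Lemma filtration_monomial k s (j : nat) :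
  (size s)%:Z = k - 2 * j%:Z -> F k (mono s).
Proof.
move=> hs; rewrite sb_filtrationE; apply: mem_lspan.
by exists s; split=> //; exists j.
Qed.

Lemma filtration_ind k (P : set A) : subspace P ->
  (forall s (j : nat), (size s)%:Z = k - 2 * j%:Z -> P (mono s)) ->
  forall x, F k x -> P x.
Proof.
move=> sP Pm x; rewrite sb_filtrationE; apply: lspan_sub => //.
by move=> _ [s [[j hs] ->]]; exact: Pm hs.
Qed.

Lemma filtration_le k l (j : nat) x : l = k + 2 * j%:Z -> F k x -> F l x.
Proof.
move=> ->; move: x; apply: filtration_ind => [|s i hs]; first exact: subspace_filtration.
by apply: (@filtration_monomial _ _ (j + i)); lia.
Qed.

Lemma filtration_creation a (n : nat) k x :
  F k x -> F (k + 1) (vprod A (- n.+1%:Z) (q a) x).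
Proof.
move: x; apply: filtration_ind => [|s j hs].
  exact/subspace_vprod/subspace_filtration.
by apply: (@filtration_monomial _ ((a, n) :: s) j) => /=; lia.
Qed.

(** Commuting the annihilation mode to the right through the word either replaces
a letter by a scalar or reaches the vacuum, which it kills. *)
Lemma filtration_annihilation a (n : nat) k x :
  F k x -> F (k - 1) (vprod A n%:Z (q a) x).
Proof.
move: x; apply: filtration_ind => [|s].
  exact/subspace_vprod/subspace_filtration.
elim: s k => [|[b m] s IH] k j hs /=.
  by rewrite va_creation; case: (subspace_filtration (k - 1)).
rewrite (q_commutator hq); apply: subspaceD; first exact: subspace_filtration.
  rewrite -[k - 1](subrK 1); apply: filtration_creation.
  by apply: (IH _ j); move: hs => /=; lia.
apply: subspaceZ; first exact: subspace_filtration.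
by apply: (@filtration_monomial _ _ j); move: hs => /=; lia.
Qed.

Lemma filtration_q a n k x : F k x -> F (k + 1) (vprod A n (q a) x).
Proof.
case: n => n Fx; last by rewrite NegzE; exact: filtration_creation.
by apply: (filtration_le (k := k - 1) (j := 1)); [lia | exact: filtration_annihilation].
Qed.

Lemma graded_creation a (n : nat) (l : int) x : sb_graded q l x ->
  sb_graded q (l + 1) (vprod A (- n.+1%:Z) (q a) x).
Proof.
move: x; apply: lspan_sub => [|_ [s [hs ->]]].
  exact/subspace_vprod/subspace_lspan.
by apply: mem_lspan; exists ((a, n) :: s); split=> //=; rewrite -addn1 PoszD hs.
Qed.

Lemma graded_sub_filtration (k l : int) (j : nat) x : l = k - 2 * j%:Z ->
  sb_graded q l x -> F k x.
Proof.
move=> hl; apply: lspan_sub => [|_ [t [ht ->]]]; first exact: subspace_lspan.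
by apply: (@filtration_monomial _ _ j); rewrite ht.
Qed.

Lemma filtration_split k x : F k x ->
  exists g y, [/\ sb_graded q k g, F (k - 2) y & x = g + y].
Proof.
move: x; apply: filtration_ind => [|s [|j] hs].
- split=> [|c _ _ [g [y [hg hy ->]]] [g' [y' [hg' hy' ->]]]].
    by exists 0, 0; rewrite addr0; split=> //; apply: subspace0; exact: subspace_lspan.
  have [_ gZD] := subspace_lspan [set x | exists s, (size s)%:Z = k /\ x = mono s].
  have [_ fZD] := subspace_filtration (k - 2).
  exists (c *: g + g'), (c *: y + y'); split; last by rewrite scalerDr addrACA.
    exact: gZD.
  exact: fZD.
- exists (mono s), 0; rewrite addr0; split=> //; last exact: subspace0 (subspace_filtration _).
  by apply: mem_lspan; exists s; split=> //; lia.
- exists 0, (mono s); rewrite add0r; split=> //; first exact: subspace0 (subspace_lspan _).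
  by apply: (@filtration_monomial _ _ j); lia.
Qed.

(** Induction on the word of x: in each term of [vprod_assoc] a mode of q^a adds at
most one letter, while x has lost its first one. *)
Lemma filtration_vprod j k n x y : F j x -> F k y -> F (j + k) (vprod A n x y).
Proof.
move=> Fx Fy; move: x Fx; apply: filtration_ind => [|s].
  exact/subspace_vprodl/subspace_filtration.
elim: s j k n y Fy => [|[a m] s IH] j k n y Fy i hs.
  rewrite va_vacuum_field; case: eqP => _; last by case: (subspace_filtration (j + k)).
  by apply: (filtration_le (k := k) (j := i)) => //; move: hs => /=; lia.
have hs' : (size s)%:Z = j - 1 - 2 * i%:Z by move: hs => /=; lia.
rewrite /=; have [N0 /(_ N0 (leqnn _)) ->] :=
  vprod_assoc y (- m.+1%:Z) n (q_even hq a) (even_sb hq (mono s)).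
apply: subspace_sum => [|p _]; first exact: subspace_filtration.
apply: subspaceZ; first exact: subspace_filtration.
apply: subspaceB; first exact: subspace_filtration.
  rewrite (_ : j + k = j - 1 + k + 1); last by lia.
  by apply: filtration_q; exact: IH Fy _ hs'.
apply: subspaceZ; first exact: subspace_filtration.
rewrite (_ : j + k = j - 1 + (k + 1)); last by lia.
by apply: IH hs'; exact: filtration_q.
Qed.

(** Two letters are saved in each term of [vprod_assoc]: in the first group the
shortened x acts through a nonnegative mode, where the induction hypothesis
applies; in the second group x has lost its first letter, and a mode q^a_j with
j >= 0 removes a letter from y. *)
Lemma sb_good_filtration : good_filtration F.
Proof.
move=> j k n x y Fx Fy; move: x Fx; apply: filtration_ind => [|s].
  exact/subspace_vprodl/subspace_filtration.
elim: s j k n y Fy => [|[a m] s IH] j k n y Fy i hs.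
  by rewrite va_vacuum_field; case: (subspace_filtration (j + k - 2)).
have hs' : (size s)%:Z = j - 1 - 2 * i%:Z by move: hs => /=; lia.
rewrite /=; have [N0 /(_ N0 (leqnn _)) ->] :=
  vprod_assoc y (- m.+1%:Z) n%:Z (q_even hq a) (even_sb hq (mono s)).
apply: subspace_sum => [|p _]; first exact: subspace_filtration.
apply: subspaceZ; first exact: subspace_filtration.
apply: subspaceB; first exact: subspace_filtration.
  rewrite (_ : j + k - 2 = j - 1 + k - 2 + 1); last by lia.
  by apply: filtration_q; rewrite -PoszD; exact: IH Fy _ hs'.
apply: subspaceZ; first exact: subspace_filtration.
rewrite (_ : j + k - 2 = j - 1 + (k - 1)); last by lia.
apply: filtration_vprod; last exact: filtration_annihilation.
exact: filtration_monomial hs'.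
Qed.

Lemma filtration_sub_Z2 k : F k `<=` Z (odd `|k|%N).
Proof.
apply: filtration_ind => [|s j hs]; first exact: subspace_lspan.
by apply: mem_lspan; exists s; split=> //; lia.
Qed.

Lemma Z2_sub_filtration b x : Z b x -> exists k, odd `|k|%N = b /\ F k x.
Proof.
apply: (@lspan_sub _ _ _ [set x | exists k, odd `|k|%N = b /\ F k x]); last first.
  move=> _ [s [hs ->]]; exists (size s)%:Z; split=> //.
  by apply: (@filtration_monomial _ _ 0); lia.
split=> [|c y z [k [hk Fy]] [l [hl Fz]]].
  by exists (b : nat); split; [case: b | case: (subspace_filtration (b : nat))].
(* Up to the factor c, the vector c y + z has the same form with y and z exchanged. *)
wlog kl : c y z k l hk hl Fy Fz / k <= l.
  move=> hwlog; case: (lerP k l) => [|/ltW lk]; first exact: hwlog.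
  have [->|c0] := eqVneq c 0; first by exists l; rewrite scale0r add0r.
  have [i [hi Fi]] := hwlog c^-1 z y l k hl hk Fz Fy lk.
  exists i; split=> //; rewrite (_ : _ + z = c *: (c^-1 *: z + y)).
    by apply: subspaceZ Fi; exact: subspace_filtration.
  by rewrite scalerDr scalerA divff // scale1r addrC.
exists l; split=> //; apply: subspaceD => //; first exact: subspace_filtration.
apply: subspaceZ; first exact: subspace_filtration.
by apply: (filtration_le (k := k) (j := (absz (l - k))./2)) => //; lia.
Qed.

(** The operator (-1)^(2R); its eigenvalues separate the two halves of the
Z_2-grading. *)
Lemma Z2_sign_operator : exists f : A -> A, linear f /\
  forall (b : bool) x, Z b x -> f x = (-1) ^+ b *: x.
Proof.
have [|f [fL fm]] := diagonal_operator hq (lam := fun s => (-1) ^+ size s).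
  by move=> s t /perm_size ->.
exists f; split=> // b; apply: lspan_sub => [|_ [s [hs ->]]]; last first.
  by rewrite fm -signr_odd hs.
split=> [|c x y /= fx fy]; last by rewrite fL fx fy scalerDr !scalerA mulrC.
have := fL (-1) 0 0; rewrite scaler0 addr0 scaleN1r addNr => ->.
by rewrite scaler0.
Qed.

Lemma sb_is_Z2_grading : is_Z2_grading Z.
Proof.
split; [split | |].
- by move=> b; exact: subspace_lspan.
- apply: sb_monomial_ind hq _ _ _ => [|s].
    split=> [|c _ _ [x0 [x1 [Z0 Z1 ->]]] [y0 [y1 [Z0' Z1' ->]]]].
      by exists 0, 0; rewrite addr0; split=> //; apply: subspace0; exact: subspace_lspan.
    have ZZD b' : subspace (Z b') by exact: subspace_lspan.
    exists (c *: x0 + y0), (c *: x1 + y1); split; last by rewrite scalerDr addrACA.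
    + by case: (ZZD false) => _; apply.
    + by case: (ZZD true) => _; apply.
  case e: (odd (size s)); [exists 0, (mono s) | exists (mono s), 0].
    split; rewrite ?add0r //; first by apply: subspace0; exact: subspace_lspan.
    by apply: mem_lspan; exists s.
  split; rewrite ?addr0 //; last by apply: subspace0; exact: subspace_lspan.
  by apply: mem_lspan; exists s.
- have [f [_ fZ]] := Z2_sign_operator => x /fZ fx /fZ; rewrite fx expr1 scaleN1r scale1r.
  move/eqP; rewrite -addr_eq0 -mulr2n -scaler_nat scaler_eq0 pnatr_eq0 /=.
  by move/eqP.
- by apply: mem_lspan; exists [::].
- move=> b c n x y /Z2_sub_filtration[k [<- Fx]] /Z2_sub_filtration[l [<- Fy]].
  rewrite (_ : _ (+) _ = odd `|(k + l)%R|%N); last by lia.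
  exact/filtration_sub_Z2/filtration_vprod.
Qed.

Lemma sb_half_integral_filtration : half_integral_filtration Z F.
Proof.
split; first exact: sb_is_Z2_grading.
split.
- by move=> k; split; [exact: subspace_filtration | exact: filtration_sub_Z2].
- by move=> k x; apply: (filtration_le (j := 1)); lia.
- exact: Z2_sub_filtration.
- by apply: (@filtration_monomial _ [::] 0).
- by move=> j k n x y; exact: filtration_vprod.
Qed.

End Filtration.

(** * The invariant form in the monomial basis *)

Section Hermitian.
Variables (C : numClosedFieldType) (A : vertexAlgebra C).
Variables (d : nat) (Om : 'M[C]_d) (q : 'I_d -> A).
Hypotheses (hq : symplectic_boson Om q) (Om_unit : Om \in unitmx).
Hypothesis (Om_skew : forall a b, Om a b = - Om b a).

Local Notation word := (seq ('I_d * nat)).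
Local Notation mono := (sb_monomial q).
Local Notation vac := (vacuum A).
Local Notation W := (invmx Om).
Local Notation T := (sb_stress Om q).
Local Notation F := (sb_filtration q).

(** The derivative with respect to the creation mode q^a_(-n-1). *)
Definition lowering (a : 'I_d) (n : nat) (x : A) : A :=
  \sum_b Om a b *: vprod A n%:Z (q b) x.

Lemma lowering_creation a c (n m : nat) x :
  lowering a n (vprod A (- m.+1%:Z) (q c) x) =
  vprod A (- m.+1%:Z) (q c) (lowering a n x)
  + ((a == c) && (n == m))%:R *: x.
Proof.
rewrite /lowering vprod_sumr.
under eq_bigr do rewrite (q_commutator hq) scalerDr -vprodZr scalerA.
rewrite big_split /= -scaler_suml; congr (_ + _ *: _).
rewrite (_ : (_ + 1 == 0) = (n == m)); last by lia.
case: (n == m); last by rewrite andbF big1 // => b _; rewrite mulr0.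
by rewrite andbT sum_mul_invmx.
Qed.

Lemma lowering_monomial a n (t : word) :
  lowering a n (mono t) = (count_mem (a, n) t)%:R *: mono (rem (a, n) t).
Proof.
elim: t => [|[c m] t IH].
  by rewrite scale0r /lowering big1 // => b _; rewrite va_creation scaler0.
rewrite /= lowering_creation IH vprodZr -pair_eqE /= [a == c]eq_sym [n == m]eq_sym.
have [e|e] := boolP ((c == a) && (m == n)).
  case/andP: e => /eqP -> /eqP ->; rewrite natrD scalerDl addrC; congr (_ + _).
  have [nt|nt] := boolP ((a, n) \in t); last first.
    by have := count_memPn nt => ->; rewrite !scale0r.
  congr (_ *: _); rewrite -[LHS]/(mono ((a, n) :: rem (a, n) t)).
  by apply: (perm_sb_monomial hq); rewrite perm_sym; exact: perm_to_rem.
by rewrite scale0r addr0 add0n.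
Qed.

(** The pairing of two monomials under derivatives: the number of ways to match
their letters with equal ones.  The recursion is the Leibniz rule of
[lowering_monomial]. *)
Fixpoint gram (s t : word) : nat :=
  if s is w :: s' then count_mem w t * gram s' (rem w t) else nilp t.

Lemma gram_gt0 s t : (0 < gram s t)%N = perm_eq s t.
Proof.
elim: s t => [|w s IH] t.
  by case: t => [|v t] //=; apply/esym/negbTE/negP => /perm_size.
rewrite muln_gt0 -has_count has_pred1 IH.
have [wt|wt] := boolP (w \in t); last first.
  apply/esym/negbTE; apply: contra wt => /perm_mem <-; exact: mem_head.
by have := perm_to_rem wt => /permPr ->; rewrite perm_cons.
Qed.

Section Form.
Variable form : {biscalar A}.
Hypotheses (hform : invariant_form T form) (hvac : form vac vac = 1).

Lemma form_q a (n : int) u v :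
  form (vprod A n (q a) u) v = 'i * form u (vprod A (- n - 1) (q a) v).
Proof.
have qE : q a = mono [:: (a, 0)] by rewrite /= va_creation_state.
have w1 : weight_space T 1 (q a).
  rewrite qE; have := weight_space_monomial hq Om_unit Om_skew [:: (a, 0)].
  by rewrite /word_weight big_seq1.
have l1 : iter 1 (virasoro T 1) (q a) = 0.
  rewrite /= {1}qE /= /virasoro (stress_q_commutator hq Om_unit Om_skew).
  rewrite va_creation vprod0r sub0r rmorphN /= divff ?pnatr_eq0 // addNr.
  by rewrite scale0r oppr0.
have [/(_ false false 1 n 1 _ _ v (q_even hq a) (even_sb hq u) w1 l1) -> _] := hform.
rewrite big_ord1 /= mul1r expr1z invr1 mul1r; congr (_ * form _ (vprod A _ _ _)).
by lia.
Qed.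

Lemma form_vac_creation a (n : nat) v : form vac (vprod A (- n.+1%:Z) (q a) v) = 0.
Proof.
have := form_q a n%:Z vac v; rewrite va_creation linear0l.
rewrite (_ : - n%:Z - 1 = - n.+1%:Z); last by lia.
by move/esym/eqP; rewrite mulf_eq0 (negPf (neq0Ci _)) /= => /eqP.
Qed.

(** The map J abstracts sigma o rho.  Its value on the vacuum and its
effect on creation modes determine it. *)
Section Conjugate.
Variable J : A -> A.
Hypotheses (JZD : antilinear J) (J_vac : J vac = vac).
Hypothesis J_creation : forall a (n : nat) x,
  J (vprod A (- n.+1%:Z) (q a) x) =
  - 'i *: \sum_b Om a b *: vprod A (- n.+1%:Z) (q b) (J x).

(** The factor - i of J and the factor i of the invariant form multiply to 1. *)
Lemma J_creation_adjoint a (n : nat) x y :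
  form (J (vprod A (- n.+1%:Z) (q a) x)) y = form (J x) (lowering a n y).
Proof.
rewrite J_creation linearZl_LR /= linear_sumlz linear_sumr mulr_sumr.
apply: eq_bigr => b _; rewrite linearZl_LR linearZr_LR /= form_q.
rewrite (_ : - - n.+1%:Z - 1 = n%:Z); last by lia.
rewrite mulrCA; congr (_ * _).
by rewrite mulrA mulNr -expr2 sqrCi opprK mul1r.
Qed.

Lemma form_J_monomials s t : form (J (mono s)) (mono t) = (gram s t)%:R.
Proof.
elim: s t => [|[a n] s IH] t /=.
  by rewrite J_vac; case: t => [|[b m] t] //=; rewrite form_vac_creation.
by rewrite J_creation_adjoint lowering_monomial linearZr_LR /= IH -natrM.
Qed.

Lemma J_hermitian x y : form (J x) y = (form (J y) x)^*.
Proof.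
move: x; apply: (sb_monomial_ind hq) => [|s].
  split=> [|c x z /= hx hz]; first by rewrite linear0r (antilinear0 JZD) linear0l rmorph0.
  by rewrite JZD linearPl linearPr /= hx hz rmorphD rmorphM.
move: y; apply: (sb_monomial_ind hq) => [|t].
  split=> [|c x z /= hx hz]; first by rewrite linear0r (antilinear0 JZD) linear0l rmorph0.
  by rewrite JZD linearPl linearPr /= hx hz rmorphD rmorphM /= conjCK.
rewrite !form_J_monomials conjC_nat; have [st|st] := boolP (perm_eq s t).
  by rewrite -!form_J_monomials (perm_sb_monomial hq st).
have := st; rewrite -gram_gt0 lt0n negbK => /eqP ->.
by have := st; rewrite perm_sym -gram_gt0 lt0n negbK => /eqP ->.
Qed.

Lemma J_positive x : x != 0 -> 0 < form (J x) x.
Proof.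
have [ss [c [[ssU ssP] xE]]] := sb_canonical_expansion hq x => x0.
have -> : form (J x) x = \sum_(s <- ss) `|c s| ^+ 2 * (gram s s)%:R.
  rewrite {1}xE (antilinear_sum JZD) linear_sumlz !big_seq; apply: eq_bigr => s sss.
  rewrite (antilinearZ JZD) linearZl_LR /= xE linear_sumr (bigD1_seq s) //=.
  rewrite big_seq_cond big1 => [|t /andP[tss ts]]; last first.
    rewrite linearZr_LR /= form_J_monomials (_ : gram s t = 0%N) ?mulr0 //.
    apply/eqP; rewrite -leqn0 leqNgt gram_gt0; apply: contra ts => st.
    by rewrite (ssP _ _ sss tss st).
  by rewrite addr0 linearZr_LR /= form_J_monomials mulrA normCKC.
have pos s : s \in ss -> 0 <= `|c s| ^+ 2 * (gram s s)%:R.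
  by move=> _; rewrite mulr_ge0 ?exprn_ge0 ?ler0n.
have [s sss cs] : exists2 s, s \in ss & c s != 0.
  apply/hasP; apply: contraNT x0 => /hasPn cs0; rewrite xE big_seq big1 // => s sss.
  by have := cs0 s sss; rewrite negbK => /eqP ->; rewrite scale0r.
rewrite (bigD1_seq s) //= ltr_pwDl //.
  by rewrite mulr_gt0 ?exprn_gt0 ?normr_gt0 // ltr0n gram_gt0.
by rewrite big_seq_cond sumr_ge0 // => t /andP[tss _]; exact: pos.
Qed.

Lemma J_graded s : sb_graded q (size s) (J (mono s)).
Proof.
elim: s => [|[a n] s IH] /=.
  by rewrite J_vac; apply: mem_lspan; exists [::].
rewrite J_creation; apply: subspaceZ; first exact: subspace_lspan.
apply: subspace_sum => [|b _]; first exact: subspace_lspan.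
apply: subspaceZ; first exact: subspace_lspan.
by rewrite -addn1 PoszD; exact: graded_creation.
Qed.

(** J acts on generators by the invertible matrix - i Om, so each letter of a word
can be replaced by the combination of letters that J maps to it. *)
Lemma J_graded_surj s : exists2 u, sb_graded q (size s) u & J u = mono s.
Proof.
elim: s => [|[b n] s [u gu Ju]].
  by exists vac => //; apply: mem_lspan; exists [::].
(* The coefficient is conjugated because J is anti-linear, and i W inverts - i Om. *)
exists (\sum_a ('i * W b a)^* *: vprod A (- n.+1%:Z) (q a) u).
  apply: subspace_sum => [|a _]; first exact: subspace_lspan.
  apply: subspaceZ; first exact: subspace_lspan.
  by rewrite /= -addn1 PoszD; exact: graded_creation.
rewrite (antilinear_sum JZD) /= -Ju.
rewrite -[RHS](contract_invmx_mul Om_unit (fun c => vprod A (- n.+1%:Z) (q c) (J u))).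
apply: eq_bigr => a _; rewrite (antilinearZ JZD) conjCK J_creation scalerA.
rewrite mulrN mulrAC -expr2 sqrCi mulN1r opprK scaler_sumr.
by apply: eq_bigr => c _; rewrite !scalerA mulrC.
Qed.

Lemma J_filtration k x : F k x -> F k (J x).
Proof.
move: x; apply: filtration_ind => [|s j hs].
  apply: (subspace_antilinear JZD); exact: subspace_filtration.
exact: graded_sub_filtration hs (J_graded s).
Qed.

Lemma J_filtration_surj k x : F k x -> exists2 u, F k u & J u = x.
Proof.
move: x; apply: filtration_ind => [|s j hs]; last first.
  by have [u gu Ju] := J_graded_surj s; exists u => //; exact: graded_sub_filtration hs gu.
split=> [|c _ _ [u Fu <-] [v Fv <-]].
  by exists 0; [apply: subspace0; exact: subspace_filtration | exact: antilinear0].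
exists (c^* *: u + v); last by rewrite JZD conjCK.
by case: (subspace_filtration q k) => _; apply.
Qed.

(** If J maps P onto itself, every nonzero element of P pairs nontrivially with
its image or its preimage under J, by positivity. *)
Lemma J_nondegenerate (P : set A) : (forall x, P x -> P (J x)) ->
  (forall x, P x -> exists2 u, P u & J u = x) -> nondegenerate_on form P.
Proof.
move=> PJ JP; have pos x : form (J x) x = 0 -> x = 0.
  by move=> x0; apply/eqP; apply: contraT => /J_positive; rewrite x0 ltxx.
split=> [x Px x0|y Py y0]; last by apply: pos; apply: y0; exact: PJ.
have [u Pu Ju] := JP x Px.
by rewrite -Ju (pos u) ?(antilinear0 JZD) // Ju x0.
Qed.

Lemma sb_nondegenerate_filtration : nondegenerate_filtration form F.
Proof.
by move=> k; apply: J_nondegenerate => x; [exact: J_filtration | exact: J_filtration_surj].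
Qed.

Lemma sb_nondegenerate : nondegenerate_on form setT.
Proof.
apply: J_nondegenerate => // x _.
move: x; apply: (sb_monomial_ind hq) => [|s]; last first.
  by have [u _ Ju] := J_graded_surj s; exists u.
split=> [|c _ _ [u _ <-] [v _ <-]]; first by exists 0 => //; exact: antilinear0.
by exists (c^* *: u + v) => //; rewrite JZD conjCK.
Qed.

Lemma form_graded_orthogonal s t : size s != size t -> form (mono s) (mono t) = 0.
Proof.
move=> st; have [u gu <-] := J_graded_surj s.
move: u gu; apply: (lspan_sub (Q := [set u | form (J u) (mono t) = 0])).
  split=> [|c x y /= hx hy]; first by rewrite /= (antilinear0 JZD) linear0l.
  by rewrite JZD linearPl /= hx hy mulr0 addr0.
move=> _ [s' [hs' ->]]; rewrite /= form_J_monomials (_ : gram s' t = 0%N) //.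
apply/eqP; rewrite -leqn0 leqNgt gram_gt0; apply: contra st => /perm_size <-.
by rewrite -eqz_nat hs'.
Qed.

End Conjugate.
End Form.
End Hermitian.

(** * The conjugation on monomials and the degree operator *)

Lemma big_cons_tuple (V : nmodType) (I : finType) (n : nat) (f : seq I -> V) :
  \sum_(t : n.+1.-tuple I) f t = \sum_i \sum_(t : n.-tuple I) f (i :: t).
Proof.
rewrite pair_big /= (reindex (fun p : I * n.-tuple I => cons_tuple p.1 p.2)) //.
exists (fun t => (thead t, behead_tuple t)) => [[i t] _|t _] /=.
  by rewrite theadE; congr (_, _); apply: val_inj.
by rewrite [RHS]tuple_eta; apply: val_inj.
Qed.

Section Conjugation.
Variables (C : numClosedFieldType) (A : vertexAlgebra C).
Variables (d : nat) (Om : 'M[C]_d) (q : 'I_d -> A).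
Hypotheses (hq : symplectic_boson Om q) (Om_unit : Om \in unitmx).
Hypothesis (Om_skew : forall a b, Om a b = - Om b a).

Local Notation word := (seq ('I_d * nat)).
Local Notation mono := (sb_monomial q).
Local Notation vac := (vacuum A).
Local Notation W := (invmx Om).
Local Notation T := (sb_stress Om q).
Local Notation F := (sb_filtration q).
Local Notation Z := (sb_Z2 q).

Variable rho : A -> A.
Hypothesis hrho : sb_conjugation Om q rho.

Lemma rho_antilinear : antilinear rho.
Proof. by case: hrho. Qed.

Lemma rho_vacuum : rho vac = vac.
Proof.
case: hrho => _ /(_ [::]) /= ->; rewrite expr0 scale1r (big_pred1 [tuple]) => [|t].
  by rewrite big_nil scale1r.
by rewrite [t]tuple0 /= eqxx.
Qed.

Lemma rho_monomial_cons a n s : rho (mono ((a, n) :: s)) =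
  - \sum_b Om a b *: vprod A (- n.+1%:Z) (q b) (rho (mono s)).
Proof.
have [_ rhoE] := hrho; rewrite !rhoE /= exprS mulN1r scaleNr; congr (- _).
rewrite (big_cons_tuple (size s) (fun t => (\prod_(w <- zip (a :: unzip1 s) t) Om w.1 w.2)
  *: mono (zip t (n :: unzip2 s)))) scaler_sumr.
apply: eq_bigr => b _; rewrite vprodZr scalerA mulrC -scalerA vprod_sumr.
congr (_ *: _); rewrite scaler_sumr; apply: eq_bigr => t _.
by rewrite /= big_cons vprodZr scalerA.
Qed.

(** The sum over all indices (b_1, ..., b_l) factors, so the definition of rho is
equivalent to this recursion on the first letter. *)
Lemma rho_creation a (n : nat) x : rho (vprod A (- n.+1%:Z) (q a) x) =
  - \sum_b Om a b *: vprod A (- n.+1%:Z) (q b) (rho x).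
Proof.
move: x; apply: (sb_monomial_ind hq) => [|s]; last exact: rho_monomial_cons.
split=> [|c x y /= hx hy].
  rewrite vprod0r (antilinear0 rho_antilinear) big1 ?oppr0 // => b _.
  by rewrite vprod0r scaler0.
rewrite vprodDr vprodZr !rho_antilinear hx hy scalerN scaler_sumr -opprD -big_split.
congr (- _); apply: eq_bigr => b _ /=.
by rewrite vprodDr vprodZr scalerDr !scalerA mulrC.
Qed.

Lemma rho_q a : rho (q a) = - \sum_b Om a b *: q b.
Proof.
have := rho_creation a 0 vac; rewrite va_creation_state rho_vacuum => ->.
by congr (- _); apply: eq_bigr => b _; rewrite va_creation_state.
Qed.

Lemma vprod_rho_q n a x :
  vprod A n (rho (q a)) x = - \sum_b Om a b *: vprod A n (q b) x.
Proof.
rewrite rho_q -scaleN1r vprodZl vprod_suml scaleN1r; congr (- _).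
by apply: eq_bigr => b _; rewrite vprodZl.
Qed.

Section Degree.
Variable sigma : A -> A.
Hypotheses (sigmaL : linear sigma)
  (sigma_monomial : forall s, sigma (mono s) = 'i ^+ size s *: mono s).

Lemma sigmaD x y : sigma (x + y) = sigma x + sigma y.
Proof. by rewrite -[x in LHS]scale1r sigmaL scale1r. Qed.

Lemma sigma0 : sigma 0 = 0.
Proof. by apply: (addIr (sigma 0)); rewrite -sigmaD !add0r. Qed.

Lemma sigmaZ c x : sigma (c *: x) = c *: sigma x.
Proof. by rewrite -[c *: x]addr0 sigmaL sigma0 addr0. Qed.

Lemma sigma_sum (I : Type) (r : seq I) (p : pred I) (f : I -> A) :
  sigma (\sum_(i <- r | p i) f i) = \sum_(i <- r | p i) sigma (f i).
Proof. exact: (big_morph sigma sigmaD sigma0). Qed.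

Lemma sigma_graded (l : int) x : sb_graded q l x -> sigma x = 'i ^ l *: x.
Proof.
move: x; apply: lspan_sub => [|_ [s [<- ->]]]; last exact: sigma_monomial.
split=> [|c x y /= hx hy]; first by rewrite /= sigma0 scaler0.
by rewrite sigmaL hx hy scalerDr !scalerA mulrC.
Qed.

Lemma sigma_creation a (n : nat) x : sigma (vprod A (- n.+1%:Z) (q a) x) =
  'i *: vprod A (- n.+1%:Z) (q a) (sigma x).
Proof.
move: x; apply: (sb_monomial_ind hq) => [|s].
  split=> [|c x y /= hx hy]; first by rewrite sigma0 !vprod0r sigma0 scaler0.
  rewrite vprodDr vprodZr !sigmaL hx hy vprodDr vprodZr scalerDr.
  by rewrite !scalerA mulrC.
rewrite -[vprod _ _ _ _]/(mono ((a, n) :: s)) !sigma_monomial vprodZr scalerA.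
by rewrite exprS.
Qed.

Definition sigma_rho x := sigma (rho x).

Lemma sigma_rho_antilinear : antilinear sigma_rho.
Proof. by move=> c x y; rewrite /sigma_rho rho_antilinear sigmaL. Qed.

Lemma sigma_rho_vacuum : sigma_rho vac = vac.
Proof. by rewrite /sigma_rho rho_vacuum (sigma_monomial [::]) expr0 scale1r. Qed.

Lemma sigma_rho_creation a (n : nat) x :
  sigma_rho (vprod A (- n.+1%:Z) (q a) x) =
  - 'i *: \sum_b Om a b *: vprod A (- n.+1%:Z) (q b) (sigma_rho x).
Proof.
rewrite /sigma_rho rho_creation -scaleN1r sigmaZ sigma_sum scaleN1r scaleNr scaler_sumr.
congr (- _); apply: eq_bigr => b _.
by rewrite sigmaZ sigma_creation !scalerA mulrC.
Qed.

Section WithForm.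
Variable form : {biscalar A}.
Hypotheses (hform : invariant_form T form) (hvac : form vac vac = 1).

Lemma sigma_rho_positive_definite :
  positive_definite_hermitian (sigma_rho_form form sigma rho).
Proof.
split=> [x y|x x0].
  exact: (J_hermitian hq Om_unit Om_skew hform hvac sigma_rho_antilinear
    sigma_rho_vacuum sigma_rho_creation).
exact: (J_positive hq Om_unit Om_skew hform hvac sigma_rho_antilinear
    sigma_rho_vacuum sigma_rho_creation).
Qed.

(** Monomials of different lengths are orthogonal already for the bilinear form,
since J preserves length. *)
Lemma graded_orthogonal_lower (l : int) x y :
  sb_graded q l x -> F (l - 2) y -> form x y = 0.
Proof.
move=> gx; move: y; apply: filtration_ind => [|t j ht].
  split=> [|c y z /= hy hz]; first by rewrite linear0r.
  by rewrite linearPr hy hz /= mulr0 addr0.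
move: x gx; apply: lspan_sub => [|_ [s [hs ->]]].
  split=> [|c y z /= hy hz]; first by rewrite /= linear0l.
  by rewrite linearPl hy hz /= mulr0 addr0.
apply: (form_graded_orthogonal hq Om_unit Om_skew hform hvac sigma_rho_antilinear
    sigma_rho_vacuum sigma_rho_creation).
by lia.
Qed.

(** A vector of a bigraded piece splits as a combination of words of the top
length plus a rest of lower degree.  The rest is orthogonal to all lower degrees,
hence vanishes by nondegeneracy. *)
Lemma sb_degree_operator : degree_operator T form F sigma.
Proof.
split=> //.
- apply: (sb_monomial_ind hq) (subspace_lspan _) _ => s; apply: mem_lspan.
  exists (word_weight s)%:Z, (size s)%:Z; split.
  + by apply: (@filtration_monomial _ _ _ _ _ _ 0); lia.
  + exact: weight_space_monomial hq Om_unit Om_skew s.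
  + by move=> y; apply: graded_orthogonal_lower; apply: mem_lspan; exists s.
- move=> h2 k x [/filtration_split [g [y [gg Fy ->]]] _ orth].
  suff -> : y = 0 by rewrite addr0; exact: sigma_graded.
  have nd := sb_nondegenerate_filtration hq Om_unit Om_skew hform hvac
    sigma_rho_antilinear sigma_rho_vacuum sigma_rho_creation.
  have [ndl _] := nd (k - 2); apply: ndl => // z Fz.
  by have := orth z Fz; rewrite linearDl (graded_orthogonal_lower gg Fz) add0r.
Qed.

End WithForm.
End Degree.
End Conjugation.

(** * The quaternionic structure for a unitary form matrix *)

Lemma conj_binz (C : numClosedFieldType) m j : (binz C m j)^* = binz C m j.
Proof.
rewrite /binz rmorphM fmorphV rmorph_prod rmorph_nat; congr (_ / _).
by apply: eq_bigr => i _; rewrite rmorphB rmorph_int rmorph_nat.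
Qed.

Lemma conj_signz (C : numClosedFieldType) (n : int) : ((-1 : C) ^ n)^* = (-1) ^ n.
Proof.
by case: n => n; rewrite ?NegzE -?exprnN ?fmorphV rmorphXn rmorphN1.
Qed.

Section Quaternionic.
Variables (C : numClosedFieldType) (A : vertexAlgebra C).
Variables (d : nat) (Om : 'M[C]_d) (q : 'I_d -> A).
Hypotheses (hq : symplectic_boson Om q) (Om_unitary : Om \is unitarymx).
Hypothesis (Om_skew : forall a b, Om a b = - Om b a).
Variable rho : A -> A.
Hypothesis hrho : sb_conjugation Om q rho.

Local Notation word := (seq ('I_d * nat)).
Local Notation mono := (sb_monomial q).
Local Notation vac := (vacuum A).
Local Notation W := (invmx Om).
Local Notation T := (sb_stress Om q).
Local Notation F := (sb_filtration q).
Local Notation Z := (sb_Z2 q).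

Let Om_unit : Om \in unitmx := unitarymx_unit Om_unitary.
Let rhoZD := rho_antilinear hrho.

Lemma conj_form_matrix a b : (Om a b)^* = W b a.
Proof. by rewrite invmx_unitary // !mxE. Qed.

Lemma conj_invmx a b : (W a b)^* = Om b a.
Proof. by rewrite -conj_form_matrix conjCK. Qed.

Lemma nested_modes (al be : 'I_d -> C) (m : int) (y : 'I_d -> A) :
  - \sum_e al e *: vprod A m (q e) (- \sum_b be b *: y b) =
  \sum_e \sum_b (al e * be b) *: vprod A m (q e) (y b).
Proof.
rewrite -sumrN; apply: eq_bigr => e _.
rewrite vprodNr scalerN opprK vprod_sumr scaler_sumr.
by apply: eq_bigr => b _; rewrite vprodZr scalerA.
Qed.

(** For n < 0 this is [rho_creation].  For n >= 0, commuting the mode through a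
word reduces the claim to the scalar identity conj(W^ac) = Om_ca, where
Om_ab Om_ce W^be = Om_ca comes from the commutators of rho(q^a) and rho(q^c). *)
Lemma rho_q_mode n a x : rho (vprod A n (q a) x) = vprod A n (rho (q a)) (rho x).
Proof.
case: n => n; last by rewrite NegzE (rho_creation hq hrho) (vprod_rho_q hq hrho).
move: x; apply: (fock_ind hq) => [||c m s].
- split=> [|c x y /= hx hy]; first by rewrite vprod0r (antilinear0 rhoZD) vprod0r.
  by rewrite vprodDr vprodZr !rhoZD hx hy vprodDr vprodZr.
- by rewrite va_creation (rho_vacuum hrho) va_creation (antilinear0 rhoZD).
move: (mono s) => x IH.
rewrite (q_commutator hq) (antilinearD rhoZD) (antilinearZ rhoZD).
rewrite !(rho_creation hq hrho) IH !(vprod_rho_q hq hrho) !nested_modes.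
under [RHS]eq_bigr => b _ do
  under eq_bigr => e _ do rewrite (q_commutator hq) scalerDr scalerA.
under [RHS]eq_bigr => b _ do rewrite big_split /=.
rewrite big_split /=; congr (_ + _).
  rewrite exchange_big; apply: eq_bigr => e _; apply: eq_bigr => b _.
  by rewrite mulrC.
case: eqP => _; last first.
  rewrite rmorph0 scale0r big1 // => b _; rewrite big1 // => e _.
  by rewrite mulr0 scale0r.
rewrite conj_invmx exchange_big -(delta_sum (fun e => Om c e *: rho x)).
apply: eq_bigr => e _; rewrite -(sum_mul_invmx Om_unit) !scaler_suml.
by apply: eq_bigr => b _; rewrite scalerA mulrAC.
Qed.

Lemma even_rho_q a : parity A false (rho (q a)).
Proof. exact: even_sb hq _. Qed.

(** By [vprod_assoc], whose coefficients are real, multiplicativity passes from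
[q a] and a word to the word with the letter [q a] in front. *)
Lemma rho_vprod n x y : rho (vprod A n x y) = vprod A n (rho x) (rho y).
Proof.
move: x n y; apply: (fock_ind hq) => [|n y|a m s IH n y].
- split=> [n y|c x z /= hx hz n y].
    by rewrite vprod0l (antilinear0 rhoZD) vprod0l.
  by rewrite vprodDl vprodZl !rhoZD hx hz vprodDl vprodZl.
- rewrite (rho_vacuum hrho) !va_vacuum_field.
  by case: eqP => // _; exact: antilinear0.
have [N0 hN] := vprod_assoc y (- m.+1%:Z) n (q_even hq a) (even_sb hq (mono s)).
have [N1 hN1] := vprod_assoc (rho y) (- m.+1%:Z) n (even_rho_q a)
  (even_sb hq (rho (mono s))).
rewrite (hN (N0 + N1)%N (leq_addr _ _)) rho_q_mode (hN1 (N0 + N1)%N (leq_addl _ _)).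
rewrite (antilinear_sum rhoZD); apply: eq_bigr => j _.
rewrite (antilinearZ rhoZD) rmorphM rmorphXn rmorphN1 /= conj_binz.
rewrite (antilinearB rhoZD) (antilinearZ rhoZD) rho_q_mode !IH rho_q_mode.
by rewrite conj_signz.
Qed.

Lemma rho_transl x : rho (transl A x) = transl A (rho x).
Proof. by rewrite !translE rho_vprod (rho_vacuum hrho). Qed.

(** Unitarity of Om turns the conjugate matrix into the transposed inverse, which
undoes the matrix in the definition of rho. *)
Lemma conj_contract_rho_q a : \sum_b (Om a b)^* *: rho (q b) = q a.
Proof.
rewrite -[RHS](contract_invmx_mul Om_unit q); apply: eq_bigr => b _.
rewrite conj_form_matrix (invmx_skew Om_unit Om_skew) (rho_q hq hrho) scaleNr scalerN opprK.
by rewrite scaler_sumr; apply: eq_bigr => c _; rewrite !scalerA mulrC.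
Qed.

Lemma rho_rho_q a : rho (rho (q a)) = - q a.
Proof.
rewrite {1}(rho_q hq hrho) -scaleN1r (antilinearZ rhoZD) rmorphN1 scaleN1r.
rewrite (antilinear_sum rhoZD) -[in RHS]conj_contract_rho_q; congr (- _).
by apply: eq_bigr => b _; rewrite (antilinearZ rhoZD).
Qed.

Lemma rho_rho_monomial s : rho (rho (mono s)) = (-1) ^+ size s *: mono s.
Proof.
elim: s => [|[a n] s IH] /=; first by rewrite !(rho_vacuum hrho) scale1r.
rewrite !rho_vprod rho_rho_q IH vprodZr -scaleN1r vprodZl scalerA exprS.
by rewrite mulrC.
Qed.

Lemma rho4 x : rho (rho (rho (rho x))) = x.
Proof.
move: x; apply: (sb_monomial_ind hq) => [|s].
  split=> [|c x y /= hx hy]; first by rewrite !(antilinear0 rhoZD).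
  by rewrite !rhoZD hx hy !conjCK.
rewrite rho_rho_monomial !(antilinearZ rhoZD) rho_rho_monomial scalerA conjCK.
by rewrite -exprMn mulrNN mulr1 expr1n scale1r.
Qed.

(** Applying rho to both factors of T replaces Om_ab by its conjugate and inserts
two copies of Om; one of them cancels against the conjugate by unitarity. *)
Lemma rho_stress : rho T = T.
Proof.
rewrite /sb_stress (antilinearZ rhoZD) fmorphV rmorph_nat; congr (_ *: _).
rewrite (antilinear_sum rhoZD).
transitivity (\sum_a vprod A (-1) (q a) (transl A (rho (q a)))).
  apply: eq_bigr => a _; rewrite (antilinear_sum rhoZD).
  rewrite -[X in vprod A _ X](conj_contract_rho_q a) vprod_suml; apply: eq_bigr => b _.
  by rewrite (antilinearZ rhoZD) rho_vprod rho_transl vprodZl.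
rewrite exchange_big; apply: eq_bigr => a _.
rewrite (rho_q hq hrho) -sumrN transl_sum vprod_sumr; apply: eq_bigr => b _.
by rewrite -scaleNr translZ vprodZr -Om_skew.
Qed.

Lemma rho_graded s : sb_graded q (size s) (rho (mono s)).
Proof.
elim: s => [|[a n] s IH].
  by rewrite /= (rho_vacuum hrho); apply: mem_lspan; exists [::].
rewrite (rho_monomial_cons hrho) -scaleN1r; apply: subspaceZ; first exact: subspace_lspan.
apply: subspace_sum => [|b _]; first exact: subspace_lspan.
apply: subspaceZ; first exact: subspace_lspan.
by rewrite /= -addn1 PoszD; exact: graded_creation.
Qed.

Lemma rho_filtration k x : F k (rho x) <-> F k x.
Proof.
have fwd y : F k y -> F k (rho y).
  move: y; apply: filtration_ind => [|s j hs].
    by apply: (subspace_antilinear rhoZD); exact: subspace_filtration.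
  exact: graded_sub_filtration hs (rho_graded s).
split=> [Fx|]; last exact: fwd.
by rewrite -[x]rho4; apply/fwd/fwd/fwd.
Qed.

Lemma rho_conjugation : conjugation T F rho.
Proof.
split.
- split; first exact: rhoZD.
  by exists (fun x => rho (rho (rho x))) => x; exact: rho4.
- exact: rho_transl.
- exact: rho_vacuum hrho.
- move=> [] r n x y px _; last by rewrite expr0 scale1r rho_vprod.
  by rewrite (odd_sb hq px) !(vprod0l, antilinear0 rhoZD) scaler0.
- by split; [exact: rho_stress | exact: rho_filtration].
Qed.

Section Sigma.
Variable sigma : A -> A.
Hypotheses (sigmaL : linear sigma)
  (sigma_monomial : forall s, sigma (mono s) = 'i ^+ size s *: mono s).

Lemma sigma4 x : sigma (sigma (sigma (sigma x))) = x.
Proof.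
move: x; apply: (sb_monomial_ind hq) => [|s].
  split=> [|c x y /= hx hy]; first by rewrite !(sigma0 sigmaL).
  by rewrite !sigmaL hx hy.
do 3! rewrite sigma_monomial ?(sigmaZ sigmaL); rewrite sigma_monomial !scalerA.
(* A word of length l contributes i^(4 l). *)
have i4 : 'i * 'i * 'i * 'i = 1 :> C.
  by rewrite -expr2 sqrCi mulN1r mulNr -expr2 sqrCi opprK.
by rewrite -!exprMn i4 expr1n scale1r.
Qed.

Lemma sigma_rho_sigma x : sigma (rho (sigma x)) = rho x.
Proof.
move: x; apply: (sb_monomial_ind hq) => [|s].
  split=> [|c x y /= hx hy].
    by rewrite (sigma0 sigmaL) (antilinear0 rhoZD) (sigma0 sigmaL).
  by rewrite sigmaL !rhoZD sigmaL hx hy.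
rewrite sigma_monomial (antilinearZ rhoZD) (sigmaZ sigmaL).
rewrite (sigma_graded sigmaL sigma_monomial (rho_graded s)) scalerA.
by rewrite rmorphXn /= conjCi -exprMn mulNr -expr2 sqrCi opprK expr1n scale1r.
Qed.

Lemma rho_rho_Z2 (b : bool) x : Z b x -> rho (rho x) = (-1) ^+ b *: x.
Proof.
move: x; apply: lspan_sub => [|_ [s [<- ->]]]; last first.
  by rewrite /= rho_rho_monomial signr_odd.
split=> [|c x y /= hx hy]; first by rewrite /= !(antilinear0 rhoZD) scaler0.
by rewrite !rhoZD hx hy conjCK scalerDr !scalerA mulrC.
Qed.

Lemma sb_quaternionic : quaternionic_structure T Z F sigma rho.
Proof.
split; first exact: rho_conjugation.
  exact: rho_rho_Z2.
split; last exact: sigma_rho_sigma.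
by exists (fun x => sigma (sigma (sigma x))) => x; exact: sigma4.
Qed.

End Sigma.
End Quaternionic.

(** * From the symplectic space to its matrix, and the theorem *)

Lemma form_matrix_skew (C : numClosedFieldType) (V : vectType C)
    (Omega : {skew_symmetric V}) (d : nat) (e : d.-tuple V) a b :
  form_matrix Omega e a b = - form_matrix Omega e b a.
Proof. by rewrite !mxE hermC expr1 mulN1r. Qed.

(** A row vector killed by the matrix gives the coordinates of a vector in the
radical of Omega. *)
Lemma form_matrix_unit (C : numClosedFieldType) (V : vectType C)
    (Omega : {skew_symmetric V}) (d : nat) (e : d.-tuple V) :
  is_psymplectic Omega -> basis_of fullv e -> form_matrix Omega e \in unitmx.
Proof.
case=> nd _ _ be; rewrite -row_free_unit; apply: inj_row_free => v v0.
pose x := \sum_i v 0 i *: tnth e i.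
have x0 : x = 0.
  apply/eqP; rewrite -memv0 -(eqP nd); apply/mem_orthovP => w _.
  rewrite (coord_basis be (memvf w)) linear_sumr big1 // => j _.
  rewrite linearZr_LR linear_sumlz /= (_ : \sum_i _ = (v *m form_matrix Omega e) 0 j).
    by rewrite v0 mxE mulr0.
  by rewrite mxE; apply: eq_bigr => i _; rewrite linearZl_LR mxE -tnth_nth.
apply/rowP => i; rewrite mxE; move: i; apply/freeP; first exact: basis_free be.
by rewrite -[RHS]x0; apply: eq_bigr => i _; rewrite -tnth_nth.
Qed.

Theorem proposition2p36 (R : realType) (V : vectType R[i])
    (Omega : {skew_symmetric V}) (d : nat) (e : d.-tuple V)
    (A : vertexAlgebra R[i]) (q : 'I_d -> A)
    (form : {biscalar A}) (rho : A -> A)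
    (Om := form_matrix Omega e) (T := sb_stress Om q)
    (Z := sb_Z2 q) (F := sb_filtration q)
    (hOmega : is_psymplectic Omega)
    (he : basis_of fullv e)
    (hq : symplectic_boson Om q)
    (hform : invariant_form T form)
    (hvac : form (vacuum A) (vacuum A) = 1)
    (hrho : sb_conjugation Om q rho) :
  [/\ half_integral_filtration Z F, good_filtration F
    & nondegenerate_filtration form F] /\
  exists sigma : A -> A,
    [/\ degree_operator T form F sigma,
        positive_definite_hermitian (sigma_rho_form form sigma rho)
      & Om \is unitarymx ->
        quaternionic_structure T Z F sigma rho /\
        graded_unitary_VOA T form Z F rho].
Proof.
have Om_skew : forall a b, Om a b = - Om b a := form_matrix_skew Omega e.
have Om_unit : Om \in unitmx := form_matrix_unit hOmega he.
have [|sigma [sL sm]] := diagonal_operator hq (lam := fun s => 'i ^+ size s).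
  by move=> s t /perm_size ->.
have J1 := sigma_rho_antilinear hrho sL.
have J2 := sigma_rho_vacuum hrho sm.
have J3 := sigma_rho_creation hq hrho sL sm.
have filt : [/\ half_integral_filtration Z F, good_filtration F
    & nondegenerate_filtration form F].
  split; first exact: sb_half_integral_filtration hq.
    exact: sb_good_filtration hq.
  exact: sb_nondegenerate_filtration hq Om_unit Om_skew _ hform hvac _ J1 J2 J3.
split=> //; exists sigma.
have deg : degree_operator T form F sigma.
  exact: sb_degree_operator hq Om_unit Om_skew _ hrho _ sL sm _ hform hvac.
have pos : positive_definite_hermitian (sigma_rho_form form sigma rho).
  exact: sigma_rho_positive_definite hq Om_unit Om_skew _ hrho _ sL sm _ hform hvac.
split=> // Om_unitary.
have quat : quaternionic_structure T Z F sigma rho.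
  exact: sb_quaternionic hq Om_unitary Om_skew _ hrho _ sL sm.
split=> //; split=> //; last by exists sigma.
  exact: sb_is_VOA hq Om_unit Om_skew.
by split=> //; exact: sb_nondegenerate hq Om_unit Om_skew _ hform hvac _ J1 J2 J3.
Qed.
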